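(* Let $r\in(0,\infty)$. The sequence $\{\alpha_j(r)\}_{j\ge0}$, together with the values $a_{j,1},b_{j,1},c_{j,1},d_{j,1},e_{j,1},f_{j,1}$ of the monomials $P^{(r)}_{j,1}$ on $V_1$, satisfies for every $j\ge0$ the system $$\begin{aligned} \delta_{j0}+L(r)^j\alpha_j(r)+r a_{j,1}+r b_{j,1}&=(2+2r)\sum_{i=0}^jL(r)^j\alpha_i(r)\alpha_{j-i}(r),\\ L(r)^j\alpha_j(r)+b_{j,1}+c_{j,1}+d_{j,1}&=4\sum_{i=0}^jL(r)^i\alpha_i(r)a_{j-i,1},\\ 2L(r)^j\alpha_j(r)+2a_{j,1}&=4\sum_{i=0}^jL(r)^i\alpha_i(r)b_{j-i,1},\\ \alpha_j(r)+r a_{j,1}+r d_{j,1}+e_{j,1}&=(2+2r)\sum_{i=0}^jL(r)^i\alpha_i(r)c_{j-i,1},\\ a_{j,1}+c_{j,1}+e_{j,1}+f_{j,1}&=4\sum_{i=0}^jL(r)^i\alpha_i(r)d_{j-i,1},\\ \alpha_j(r)+c_{j,1}+r d_{j,1}+r f_{j,1}&=(2+2r)\sum_{i=0}^jL(r)^i\alpha_i(r)e_{j-i,1},\\ 2d_{j,1}+2e_{j,1}&=4\sum_{i=0}^jL(r)^i\alpha_i(r)f_{j-i,1}, \end{aligned}$$ with initial data $\alpha_0(r)=a_{0,1}=b_{0,1}=c_{0,1}=d_{0,1}=e_{0,1}=f_{0,1}=1$ and $\alpha_1(r)=\tfrac16$.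
   Context: Let $q_0,q_1,q_2$ be the vertices of a triangle in the plane, $F_i(x)=\tfrac12(x-q_i)+q_i$, and $F_{ij}=F_i\circ F_j$ for $i,j\in\{0,1,2\}$; indices of the $q_i$ are cyclic mod 3. The Sierpinski gasket $SG$ is the unique nonempty compact set with $SG=\bigcup_{i,j}F_{ij}SG$. Put $V_0=\{q_0,q_1,q_2\}$ (the boundary), $V_{m+1}=\bigcup_{i,j}F_{ij}V_m$. The graph $\Gamma_m$ has vertex set $V_m$ and an edge $x\sim_m y$ when $x=F_wq_j$, $y=F_wq_k$, $j\ne k$, for some $F_w$ a composition of $m$ of the maps $F_{ij}$. Fix $r\in(0,\infty)$ and set $D(r)=9r^2+26r+15$, $r_0(r)=\frac{6r(r+2)}{D(r)}$, $r_1(r)=\frac{6(r+2)}{D(r)}$, $\mu_0(r)=\frac1{3(2r+1)}$, $\mu_1(r)=\frac r{3(2r+1)}$, $L(r)=\frac{2r(r+2)}{(2r+1)D(r)}$, $\lambda_{\mathrm{sym}}(r)=r_0(r)$, $\lambda_{\mathrm{skew}}(r)=\frac{2r}{D(r)}$. Resistances: $\mathrm{res}_0(x,y)=1$ on edges of $\Gamma_0$, and $\mathrm{res}_{m+1}(F_{ij}x,F_{ij}y)=r_0(r)\,\mathrm{res}_m(x,y)$ if $i=j$, $=r_1(r)\,\mathrm{res}_m(x,y)$ if $i\neq j$. Energy: $\mathcal{E}_r(u,v)=\lim_{m\to\infty}\sum_{x\sim_m y}\mathrm{res}_m(x,y)^{-1}(u(x)-u(y))(v(x)-v(y))$ (each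 edge counted once); $\operatorname{dom}\mathcal{E}_r$ is the set of (continuous) functions $u$ on $SG$ with $\mathcal{E}_r(u,u)<\infty$. Measure: $\mu_r$ is the self-similar Borel probability measure on $SG$ with $\mu_r(F_{ij}A)=\mu_0(r)\mu_r(A)$ if $i=j$ and $=\mu_1(r)\mu_r(A)$ if $i\ne j$. Laplacian: $u\in\operatorname{dom}\Delta_r$ with $\Delta_ru=f$ means that $u\in\operatorname{dom}\mathcal{E}_r$, $f$ is continuous on $SG$, and $-\mathcal{E}_r(u,v)=\int_{SG}vf\,d\mu_r$ for all $v\in\operatorname{dom}\mathcal{E}_r$ vanishing on $V_0$. Boundary derivatives: $\partial_{n,r}u(q_i)=\lim_{m\to\infty}\lambda_{\mathrm{sym}}(r)^{-m}(2u(q_i)-u(F_{ii}^mq_{i+1})-u(F_{ii}^mq_{i-1}))$, $\ \partial_{T,r}u(q_i)=\lim_{m\to\infty}\lambda_{\mathrm{skew}}(r)^{-m}(u(F_{ii}^mq_{i+1})-u(F_{ii}^mq_{i-1}))$. A polynomial is a function $P$ on $SG$ with $\Delta_r^{n+1}P=0$ for some $n\ge0$. The space of such $P$ for fixed $n$ has dimension $3n+3$ and $P$ is uniquely determined by the values $\Delta_r^lP(q_0),\partial_{n,r}\Delta_r^lP(q_0),\partial_{T,r}\Delta_r^lP(q_0)$, $0\le l\le n$. The monomials $P^{(r)}_{j,k}$ ($j\ge0$, $k=1,2,3$) are the polynomials determined by $\Delta_r^lP^{(r)}_{j,k}(q_0)=\delta_{jl}\delta_{k1}$, $\partial_{n,r}\Delta_r^lP^{(r)}_{j,k}(q_0)=\delta_{jl}\delta_{k2}$,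 $\partial_{T,r}\Delta_r^lP^{(r)}_{j,k}(q_0)=\delta_{jl}\delta_{k3}$ for all $l\ge0$. Put $\alpha_j(r)=P^{(r)}_{j,1}(q_1)$. Values on $V_1$ (dependence on $r$ suppressed): $a_{j,1}=P^{(r)}_{j,1}(F_{01}q_1)$, $b_{j,1}=P^{(r)}_{j,1}(F_{01}q_2)$, $c_{j,1}=P^{(r)}_{j,1}(F_{11}q_0)$, $d_{j,1}=P^{(r)}_{j,1}(F_{10}q_2)$, $e_{j,1}=P^{(r)}_{j,1}(F_{11}q_2)$, $f_{j,1}=P^{(r)}_{j,1}(F_{12}q_2)$. (The values at the mirror-image points under the reflection exchanging $q_1,q_2$ are the same.) *)

(* Defs.v *)
From HB Require Import structures.
From mathcomp Require Import all_boot all_order all_algebra.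
From mathcomp Require Import all_classical all_reals all_analysis.
Import Order.TTheory GRing.Theory Num.Theory.
Import numFieldNormedType.Exports.

Set Implicit Arguments.
Unset Strict Implicit.
Unset Printing Implicit Defensive.

Local Open Scope classical_set_scope.
Local Open Scope ring_scope.

Notation plane R := (R * R)%type (only parsing).

(* The plane with its Borel sigma-algebra; convertible to [plane R]. *)
Definition borel_plane (R : realType) := g_sigma_algebraType (@open (plane R)).

Definition is_triangle (R : realType) (q : 'I_3 -> plane R) : Prop :=
  ((q 1).1 - (q 0).1) * ((q 2).2 - (q 0).2)
    != ((q 1).2 - (q 0).2) * ((q 2).1 - (q 0).1).

Definition F1 (R : realType) (q : 'I_3 -> plane R) (i : 'I_3) (x : plane R)
  : plane R := 2^-1 *: (x - q i) + q i.

Definition F (R : realType) (q : 'I_3 -> plane R) (i j : 'I_3) (x : plane R)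
  : plane R := F1 q i (F1 q j x).

Definition is_gasket (R : realType) (q : 'I_3 -> plane R) (K : set (plane R))
  : Prop :=
  [/\ K !=set0, compact K &
      K = \bigcup_(ij in [set: 'I_3 * 'I_3]) (F q ij.1 ij.2 @` K)].

Definition V0 (R : realType) (q : 'I_3 -> plane R) : set (plane R) := range q.

Definition Dpoly (R : realType) (r : R) : R := 9 * r ^+ 2 + 26 * r + 15.
Definition r0 (R : realType) (r : R) : R := 6 * r * (r + 2) / Dpoly r.
Definition r1 (R : realType) (r : R) : R := 6 * (r + 2) / Dpoly r.
Definition mu0 (R : realType) (r : R) : R := (3 * (2 * r + 1))^-1.
Definition mu1 (R : realType) (r : R) : R := r / (3 * (2 * r + 1)).
Definition L (R : realType) (r : R) : R := 2 * r * (r + 2) / ((2 * r + 1) * Dpoly r).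
Definition lambda_sym (R : realType) (r : R) : R := r0 r.
Definition lambda_skew (R : realType) (r : R) : R := 2 * r / Dpoly r.

(* A word [:: (i1, j1); ...; (im, jm)] encodes
   F_w = F_{i1 j1} o ... o F_{im jm}. *)
Definition Fw (R : realType) (q : 'I_3 -> plane R) (w : seq ('I_3 * 'I_3))
  (x : plane R) : plane R := foldr (fun ij y => F q ij.1 ij.2 y) x w.

(* Common resistance of the three edges F_w q_j -- F_w q_k of a cell: unfolding
   of res_{m+1}(F_{ij} x, F_{ij} y) = r0 or r1 times res_m(x, y), from
   res_0 = 1. *)
Definition res (R : realType) (r : R) (w : seq ('I_3 * 'I_3)) : R :=
  \prod_(ij <- w) (if ij.1 == ij.2 then r0 r else r1 r).

(* Sum over the edges of Gamma_m.  Two distinct m-cells share at most one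
   vertex, so each edge {F_w q_j, F_w q_k} comes from exactly one word w and
   exactly one pair j < k. *)
Definition graph_energy (R : realType) (q : 'I_3 -> plane R) (r : R)
  (u v : plane R -> R) (m : nat) : R :=
  \sum_(w : m.-tuple ('I_3 * 'I_3)) \sum_(j < 3) \sum_(k < 3 | (j < k)%N)
    (res r w)^-1 * (u (Fw q w (q j)) - u (Fw q w (q k)))
                 * (v (Fw q w (q j)) - v (Fw q w (q k))).

Definition energy (R : realType) (q : 'I_3 -> plane R) (r : R)
  (u v : plane R -> R) : R := limn (graph_energy q r u v).

(* Functions on the gasket K are represented by functions on the plane whose
   values off K are irrelevant.  Energies [graph_energy q r u u] are nonnegative
   and nondecreasing in m, so a finite limit is the same as convergence in R. *)
Definition dom_energy (R : realType) (q : 'I_3 -> plane R) (K : set (plane R))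
  (r : R) (u : plane R -> R) : Prop :=
  {within K, continuous u} /\ cvgn (graph_energy q r u u).

(* A Borel probability measure on K, seen as one on the plane carried by K. *)
Definition is_self_similar_measure (R : realType) (q : 'I_3 -> plane R)
  (K : set (plane R)) (r : R) (mu : probability (borel_plane R) R) : Prop :=
  mu K = 1%E /\
  forall (i j : 'I_3) (A : set (borel_plane R)), measurable A -> A `<=` K ->
    mu (F q i j @` A) = ((if i == j then mu0 r else mu1 r)%:E * mu A)%E.

(* [is_laplacian q K r mu u f] : u is in the domain and its Laplacian is f. *)
Definition is_laplacian (R : realType) (q : 'I_3 -> plane R)
  (K : set (plane R)) (r : R) (mu : probability (borel_plane R) R)
  (u f : plane R -> R) : Prop :=
  [/\ dom_energy q K r u, {within K, continuous f} &
      forall v : plane R -> R, dom_energy q K r v ->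
        (forall x, V0 q x -> v x = 0) ->
        - energy q r u v = \int[mu]_(x in K) (v x * f x)].

Fixpoint is_iter_laplacian (R : realType) (q : 'I_3 -> plane R)
  (K : set (plane R)) (r : R) (mu : probability (borel_plane R) R) (l : nat)
  (u f : plane R -> R) : Prop :=
  if l is l'.+1 then
    exists g, is_iter_laplacian q K r mu l' u g /\ is_laplacian q K r mu g f
  else forall x, K x -> f x = u x.

(* Index arithmetic on 'I_3 is modulo 3. *)
Definition has_normal_derivative (R : realType) (q : 'I_3 -> plane R) (r : R)
  (u : plane R -> R) (i : 'I_3) (d : R) : Prop :=
  (fun m => lambda_sym r ^- m *
     (2 * u (q i) - u (iter m (F q i i) (q (i + 1)))
                  - u (iter m (F q i i) (q (i - 1))))) @ \oo --> d.

Definition has_tangential_derivative (R : realType) (q : 'I_3 -> plane R)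
  (r : R) (u : plane R -> R) (i : 'I_3) (d : R) : Prop :=
  (fun m => lambda_skew r ^- m *
     (u (iter m (F q i i) (q (i + 1)))
      - u (iter m (F q i i) (q (i - 1))))) @ \oo --> d.

Definition is_polynomial (R : realType) (q : 'I_3 -> plane R)
  (K : set (plane R)) (r : R) (mu : probability (borel_plane R) R)
  (P : plane R -> R) : Prop :=
  exists n : nat, is_iter_laplacian q K r mu n.+1 P (cst 0).

(* P_{j,k}, k = 1, 2, 3. *)
Definition is_monomial (R : realType) (q : 'I_3 -> plane R)
  (K : set (plane R)) (r : R) (mu : probability (borel_plane R) R)
  (j k : nat) (P : plane R -> R) : Prop :=
  is_polynomial q K r mu P /\
  forall l : nat, exists f : plane R -> R,
    [/\ is_iter_laplacian q K r mu l P f,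
        f (q 0) = ((j == l) && (k == 1%N))%:R,
        has_normal_derivative q r f 0 ((j == l) && (k == 2%N))%:R &
        has_tangential_derivative q r f 0 ((j == l) && (k == 3%N))%:R].

(* Main.v *)
Require Import Defs.
From HB Require Import structures.
From mathcomp Require Import all_boot all_order all_algebra all_fingroup.
From mathcomp Require Import all_classical all_reals all_analysis.
From mathcomp Require Import measurable_realfun.
From mathcomp Require Import ring lra.
Import Order.TTheory GRing.Theory Num.Theory.
Import numFieldNormedType.Exports.

Set Implicit Arguments.
Unset Strict Implicit.
Unset Printing Implicit Defensive.

Local Open Scope classical_set_scope.
Local Open Scope ring_scope.

(* A function with a Laplacian is studied only through its values at the points
   F_w q_k, i.e. as a function of words.  Testing the weak equation against
   piecewise harmonic bumps shows that the normal derivatives of u on the two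
   cells meeting at a junction cancel, where the normal derivative at q_k is
   2u(q_k) - u(q_{k+1}) - u(q_{k-1}) plus the integral of (Delta u) h_k, with h_k
   harmonic and h_k(q_l) = delta_{kl}; moreover this property, which is invariant
   under restriction to cells (with the factor L) and under relabelling the three
   corners, determines Delta u from u.  A polynomial whose iterated Laplacians all
   have zero value, normal and tangential derivative at q_0 vanishes: from the top
   down each Laplacian is harmonic, and a harmonic function is determined by its
   three jets at q_0.  So a polynomial with trivial derivative data at q_0 equals
   the sum of (Delta^i u)(q_0) P_i.  At a junction x, move both cells to q_0, add
   the two restrictions of P_j with their conductances as weights and symmetrize
   under q_1 <-> q_2: all derivative data cancel, and evaluating this expansion at
   q_1 gives the equation of the system attached to x. *)

(** * Harmonic extension coefficients *)

(** Passing to words pays off twice. The triangle is arbitrary, so its symmetries are affine maps,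
    and the invariance of gasket, energy and measure under them would each need a proof; on words a
    symmetry merely renames indices. And the junction condition ranges over all words, so
    restricting it to a cell means prefixing a word, with no transport of test functions. Iterated
    Laplacians are given by a relation, with separate witnesses for every order and for the
    polynomial condition; uniqueness on words merges them into one sequence. The number and shape of
    the equations come from V_1: its twelve junctions form seven orbits under the reflection. Two
    cells [(i, i)] and [(j, j)] with distinct indices never meet, so a junction joins either two
    cells of conductance 1 / r1, whence the factor 4, or one such cell and one of conductance 1 /
    r0, whence 2 + 2r because 1 / r1 = r / r0. *)

Notation cell := ('I_3 * 'I_3)%type.
Notation corner := ('I_3 * 'I_3 * 'I_3)%type.

Lemma I3_ind (Q : 'I_3 -> Prop) : Q 0 -> Q 1 -> Q 2 -> forall i, Q i.
Proof.
move=> Q0 Q1 Q2 [[|[|[|//]]] i_lt].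
- by have -> : Ordinal i_lt = 0 by exact: val_inj.
- by have -> : Ordinal i_lt = 1 by exact: val_inj.
- by have -> : Ordinal i_lt = 2 by exact: val_inj.
Qed.

Lemma sum3 (V : nmodType) (g : 'I_3 -> V) : \sum_i g i = g 0 + g 1 + g 2.
Proof.
rewrite !big_ord_recl big_ord0 addr0 addrA.
by congr (g _ + g _ + g _); apply: val_inj.
Qed.

Lemma I3E : ((0 == 1 :> 'I_3) = false) * ((0 == 2 :> 'I_3) = false) *
  ((1 == 0 :> 'I_3) = false) * ((1 == 2 :> 'I_3) = false) *
  ((2 == 0 :> 'I_3) = false) * ((2 == 1 :> 'I_3) = false) *
  ((0 + 1 : 'I_3) = 1) * ((0 - 1 : 'I_3) = 2) * ((1 + 1 : 'I_3) = 2) *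
  ((1 - 1 : 'I_3) = 0) * ((2 + 1 : 'I_3) = 0) * ((2 - 1 : 'I_3) = 1).
Proof. by do !split => //; apply: val_inj. Qed.

(* Gluing of corners: the corner q_k of the cell (i, j) is identified with
   exactly one other corner; the three boundary points are the fixed points. *)
Definition mate (x : corner) : corner :=
  let: (i, j, k) := x in if j == k then (j, i, i) else (i, k, j).

Definition bdry (x : corner) : bool :=
  let: (i, j, k) := x in (i == j) && (j == k).

Lemma mateK : involutive mate.
Proof.
move=> [[i j] k] /=; have [<-|jk] := eqVneq j k; first by rewrite /= eqxx.
by rewrite /= eq_sym (negbTE jk).
Qed.

Lemma bdry_mate x : bdry (mate x) = bdry x.
Proof.
case: x => [[i j] k] /=; have [->|jk] := eqVneq j k => /=.
  by rewrite eqxx andbT eq_sym andbT.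
by rewrite andbF eq_sym andbC eq_sym (negbTE jk).
Qed.

Lemma mate_bdry x : bdry x -> mate x = x.
Proof. by case: x => [[i j] k] /= /andP[/eqP-> /eqP->]; rewrite eqxx. Qed.

Lemma mate_neq x : ~~ bdry x -> mate x != x.
Proof.
case: x => [[i j] k] /=; have [->|jk] := eqVneq j k.
  rewrite andbT => ij; apply/negP => /eqP[kEi _ _].
  by rewrite kEi eqxx in ij.
by move=> _; apply/negP => /eqP[kEj _]; rewrite kEj eqxx in jk.
Qed.

Section Coefficients.
Context {R : realType}.
Implicit Types (r : R) (c : cell) (x : corner).

Notation vec := ('I_3 -> R).
Implicit Types b : vec.

Definition cnd r c : R := if c.1 == c.2 then (r0 r)^-1 else (r1 r)^-1.
Definition msr r c : R := if c.1 == c.2 then mu0 r else mu1 r.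

(* Values, up to the factor [Dpoly r], at the corner q_k of the cell (i, j) of
   the harmonic function equal to 1 at q_l and to 0 at the other two boundary
   points: the solution of the network equations on V_1. *)
Definition hnum r (i j k l : 'I_3) : R :=
  if i == l then
    if j == l then
      if k == l then Dpoly r else 3 * r ^+ 2 + 14 * r + 15
    else if k == l then 3 * r ^+ 2 + 14 * r + 15
    else if k == j then 3 * r ^+ 2 + 10 * r + 7
    else 3 * r ^+ 2 + 12 * r + 11
  else if j == l then
    if k == l then 3 * r ^+ 2 + 10 * r + 7
    else if k == i then 3 * r ^+ 2 + 7 * r
    else 3 * r ^+ 2 + 7 * r + 2
  else if j == i then
    if k == l then 3 * r ^+ 2 + 7 * r
    else if k == i then 0
    else 3 * r ^+ 2 + 5 * r
  else if k == l then 3 * r ^+ 2 + 7 * r + 2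
  else if k == i then 3 * r ^+ 2 + 5 * r
  else 3 * r ^+ 2 + 6 * r + 1.

Definition hv r c k l : R := hnum r c.1 c.2 k l / Dpoly r.

Definition hext r c b : vec := fun k => \sum_l hv r c k l * b l.

Definition bvec (l : 'I_3) : vec := fun k => (k == l)%:R.

Definition flux b : vec := fun k => \sum_l (b k - b l).

Lemma Dpoly_gt0 r : 0 < r -> 0 < Dpoly r.
Proof. by move=> r_gt0; rewrite /Dpoly; nra. Qed.

Lemma cnd_gt0 r c : 0 < r -> 0 < cnd r c.
Proof.
move=> r_gt0; rewrite /cnd /r0 /r1; case: ifP => _; rewrite invr_gt0 divr_gt0 //.
- by nra.
- exact: Dpoly_gt0.
- by nra.
- exact: Dpoly_gt0.
Qed.

Lemma msr_gt0 r c : 0 < r -> 0 < msr r c.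
Proof.
move=> r_gt0; rewrite /msr /mu0 /mu1.
case: ifP => _; rewrite ?invr_gt0 ?divr_gt0 //; nra.
Qed.

Lemma Dpoly_neq0 r : 0 < r -> Dpoly r != 0.
Proof. by move/Dpoly_gt0/lt0r_neq0. Qed.

Lemma side_conditions r : 0 < r ->
  [/\ r != 0, r + 2 != 0, 2 * r + 1 != 0, 9 * r ^+ 2 + 26 * r + 15 != 0
    & 3 != 0 :> R].
Proof.
move=> r_gt0; split; try exact: lt0r_neq0.
- by apply: lt0r_neq0; lra.
- by apply: lt0r_neq0; lra.
- exact: Dpoly_neq0.
Qed.

(** Mass and conductance are in the same ratio for all nine cells. Hence one factor [L r] per level
    relates the Laplacian of a restriction to the restricted Laplacian, whatever the cell. *)
Lemma msrE r c : 0 < r -> msr r c = L r * cnd r c.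
Proof.
move=> /side_conditions[? ? ? ? ?]; rewrite /msr /L /cnd /mu0 /mu1 /r0 /r1 /Dpoly.
by case: ifP => _; field; do !(apply/andP; split).
Qed.

Lemma big_cell (V : nmodType) (g : cell -> V) :
  \sum_c g c = \sum_i \sum_j g (i, j).
Proof. by rewrite pair_bigA /=; apply: eq_bigr => -[]. Qed.

Lemma big_corner (V : nmodType) (g : corner -> V) :
  \sum_x g x = \sum_c \sum_k g (c, k).
Proof. by rewrite pair_bigA /=; apply: eq_bigr => -[]. Qed.

Lemma sum_msr r : 0 < r -> \sum_c msr r c = 1.
Proof.
move=> /side_conditions[? ? ? ? ?].
rewrite big_cell !sum3 /msr /= ?eqxx ?I3E /mu0 /mu1.
by field.
Qed.

Lemma hv_mate r (x y : corner) l : mate x = y -> hv r x.1 x.2 l = hv r y.1 y.2 l.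
Proof.
move=> <-; case: x => [[i j] k] /=; rewrite /hv; congr (_ / _).
by elim/I3_ind: i; elim/I3_ind: j; elim/I3_ind: k; elim/I3_ind: l;
  rewrite /= /hnum ?eqxx ?I3E /= ?eqxx ?I3E.
Qed.

Lemma hv_diag r (k l : 'I_3) : 0 < r -> hv r (k, k) k l = (k == l)%:R.
Proof.
move=> r_gt0; rewrite /hv /hnum /=; have [_|kl] := eqVneq k l.
  by rewrite divff ?Dpoly_neq0.
by rewrite eqxx mul0r.
Qed.

Lemma sum_hv r c k : 0 < r -> \sum_l hv r c k l = 1.
Proof.
move=> /side_conditions[? ? ? ? ?]; rewrite sum3 /hv; case: c => i j /=.
by elim/I3_ind: i; elim/I3_ind: j; elim/I3_ind: k;
  rewrite /hnum ?eqxx ?I3E /Dpoly; field.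
Qed.

Lemma hnum_ge0 r i j k l : 0 < r -> 0 <= hnum r i j k l.
Proof.
move=> r_gt0; have := Dpoly_gt0 r_gt0; have : 0 < r ^+ 2 by rewrite exprn_gt0.
by rewrite /hnum; do !case: ifP => _; lra.
Qed.

Lemma hv_ge0 r c k l : 0 < r -> 0 <= hv r c k l.
Proof.
by move=> r_gt0; rewrite divr_ge0 ?hnum_ge0 // ltW // Dpoly_gt0.
Qed.

(** [3 * r ^+ 2 + 10 * r + 7] is the smallest numerator in [hnum] with [i = l]: at each of its
    corners the cell [(i, j)] gives the boundary value at q_i at least the weight [1 - theta r]. *)
Definition theta r : R := 1 - (3 * r ^+ 2 + 10 * r + 7) / Dpoly r.

Lemma theta_ge0 r : 0 < r -> 0 <= theta r.
Proof.
move=> r_gt0; have := Dpoly_gt0 r_gt0 => D_gt0; rewrite /theta subr_ge0.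
by rewrite ler_pdivrMr // mul1r /Dpoly; nra.
Qed.

Lemma theta_lt1 r : 0 < r -> theta r < 1.
Proof.
move=> r_gt0; have := Dpoly_gt0 r_gt0 => D_gt0; rewrite /theta.
by rewrite gtrBl divr_gt0 //; nra.
Qed.

Lemma hv_ge_theta r c k : 0 < r -> 1 - theta r <= hv r c k c.1.
Proof.
move=> r_gt0; have D_gt0 := Dpoly_gt0 r_gt0.
rewrite /theta subKr /hv ler_pM2r ?invr_gt0 // /hnum eqxx /Dpoly.
have : 0 < r ^+ 2 by rewrite exprn_gt0.
by do !case: ifP => _; lra.
Qed.

Definition within_bounds (lo hi : R) b := forall k, lo <= b k <= hi.

(** All three corners of a cell put weight at least [1 - theta r] on the same boundary value
    [b c.1]; only the remaining share [theta r] can spread them apart. Continuity of harmonic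
    functions rests on this contraction. *)
Lemma hext_contract r c b lo hi : 0 < r -> within_bounds lo hi b ->
  exists lo' hi', [/\ within_bounds lo' hi' (hext r c b), lo <= lo', hi' <= hi
    & hi' - lo' = theta r * (hi - lo)].
Proof.
move=> r_gt0 b_in; have t_lt1 := theta_lt1 r_gt0; have t_ge0 := theta_ge0 r_gt0.
pose i := c.1; have /andP[lo_le le_hi] := b_in i.
exists ((1 - theta r) * b i + theta r * lo), ((1 - theta r) * b i + theta r * hi).
split; [|by nra|by nra|by ring].
(* [g] is what remains of the weights once [1 - theta r] is removed at [i]: nonnegative, of total
   [theta r]. *)
move=> k; pose g l := hv r c k l - (l == i)%:R * (1 - theta r).
have g_ge0 l : 0 <= g l.
  rewrite /g; have [->|_] := eqVneq l i; last by rewrite mul0r subr0 hv_ge0.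
  by rewrite mul1r subr_ge0 hv_ge_theta.
have sum_g : \sum_l g l = theta r.
  have delta_sum : \sum_l ((l == i)%:R : R) = 1.
    by rewrite (bigD1 i) //= eqxx big1 ?addr0 // => l /negbTE->.
  by rewrite sumrB sum_hv // -mulr_suml delta_sum mul1r; ring.
have -> : hext r c b k = (1 - theta r) * b i + \sum_l g l * b l.
  under [X in _ = _ + X]eq_bigr do rewrite mulrBl.
  have delta_b : \sum_l (l == i)%:R * (1 - theta r) * b l = (1 - theta r) * b i.
    rewrite (bigD1 i) //= eqxx mul1r big1 ?addr0 // => l /negbTE->.
    by rewrite !mul0r.
  by rewrite sumrB delta_b addrC subrK.
rewrite -sum_g !mulr_suml !lerD2l; apply/andP; split; apply: ler_sum => l _;
  by apply: ler_wpM2l; rewrite ?g_ge0 //; case/andP: (b_in l).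
Qed.

Lemma hext_bounds r c b lo hi : 0 < r -> within_bounds lo hi b ->
  within_bounds lo hi (hext r c b).
Proof.
move=> r_gt0 /(hext_contract c r_gt0)[lo' [hi' [Hb lo_le hi_le _]]] k.
case/andP: (Hb k) => h1 h2; apply/andP; split.
  exact: le_trans lo_le h1.
exact: le_trans h2 hi_le.
Qed.

Lemma hext_cst r c (z : R) k : 0 < r -> hext r c (fun=> z) k = z.
Proof. by move=> r_gt0; rewrite /hext -mulr_suml sum_hv // mul1r. Qed.

Lemma hext_mate r b (x : corner) :
  hext r (mate x).1 b (mate x).2 = hext r x.1 b x.2.
Proof.
by apply: eq_bigr => l _; congr (_ * _); apply/esym/hv_mate.
Qed.

Lemma hext_diag r b k : 0 < r -> hext r (k, k) b k = b k.
Proof.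
move=> r_gt0; rewrite /hext (bigD1 k) //= hv_diag // eqxx mul1r big1 ?addr0 //.
by move=> l lk; rewrite hv_diag // eq_sym (negbTE lk) mul0r.
Qed.

(* This is what makes the weights 1/3 in [mom] below invariant under refinement. *)
Lemma sum_msr_hv r l : 0 < r -> \sum_c msr r c * \sum_k hv r c k l = 1.
Proof.
move=> /side_conditions[? ? ? ? ?].
rewrite big_cell !sum3 /hv /hnum /msr /= ?eqxx ?I3E /mu0 /mu1 /Dpoly.
by elim/I3_ind: l; rewrite ?eqxx ?I3E; field; do !(apply/andP; split).
Qed.

(** Kirchhoff's law on V_1, which justifies calling [hnum] harmonic. *)
Lemma flux_hv_junction r (x : corner) l : 0 < r -> ~~ bdry x ->
  cnd r x.1 * flux (hv r x.1 ^~ l) x.2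
  = - (cnd r (mate x).1 * flux (hv r (mate x).1 ^~ l) (mate x).2).
Proof.
move=> /side_conditions[? ? ? ? ?]; case: x => [[i j] k] /=.
rewrite /flux /cnd /r0 /r1.
by elim/I3_ind: i; elim/I3_ind: j; elim/I3_ind: k => //= _;
  elim/I3_ind: l; rewrite !sum3 /hv /hnum ?eqxx ?I3E /= ?eqxx ?I3E /Dpoly;
  field; do !(apply/andP; split).
Qed.

(** This fixes the size of [r0]: refining V_0 to V_1 does not change the boundary flux of a harmonic
    function, so its energy is the same at all levels. *)
Lemma flux_hv_bdry r (k l : 'I_3) : 0 < r ->
  cnd r (k, k) * flux (hv r (k, k) ^~ l) k = flux (bvec l) k.
Proof.
move=> /side_conditions[? ? ? ? ?]; rewrite /flux /cnd /r0 /bvec /= eqxx.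
by elim/I3_ind: k; elim/I3_ind: l;
  rewrite !sum3 /hv /hnum ?eqxx ?I3E ?mulr1n ?mulr0n /Dpoly; field; do !(apply/andP; split).
Qed.

(** [lambda_skew] is the eigenvalue, under restriction to the corner cell at q_0, of the harmonic
    functions that are skew under q_1 <-> q_2. *)
Lemma hv_skew r : 0 < r -> hv r (0, 0) 1 1 - hv r (0, 0) 1 2 = lambda_skew r.
Proof.
move=> /side_conditions[? ? ? ? ?].
by rewrite /hv /hnum /lambda_skew ?eqxx ?I3E /Dpoly; field.
Qed.

Lemma hv_perm r (s : 'I_3 -> 'I_3) c k l : injective s ->
  hv r (s c.1, s c.2) (s k) (s l) = hv r c k l.
Proof. by move=> s_inj; rewrite /hv /hnum !(inj_eq s_inj). Qed.

End Coefficients.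

(** * Functions on words *)

Section Symbolic.
Context {R : realType} (r : R).
Hypothesis r_gt0 : 0 < r.

Notation vec := ('I_3 -> R).
Notation sfun := (seq cell -> 'I_3 -> R).
Implicit Types (U V : sfun) (w : seq cell) (b : vec) (c : cell) (x : corner).

Lemma L_gt0 : 0 < L r.
Proof.
have r_pos := r_gt0; have r2 : 0 < r + 2 by lra.
have r1 : 0 < 2 * r + 1 by lra.
by rewrite /L divr_gt0 // !mulr_gt0 // Dpoly_gt0.
Qed.

Lemma flux_sym b b' : \sum_k b k * flux b' k = \sum_k b' k * flux b k.
Proof. by rewrite /flux !sum3; ring. Qed.

Lemma flux_lin (y z : R) b b' k :
  flux (fun l => y * b l + z * b' l) k = y * flux b k + z * flux b' k.
Proof. by rewrite /flux !sum3; ring. Qed.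

Lemma energy_ge0 b : 0 <= \sum_k b k * flux b k.
Proof.
have -> : \sum_k b k * flux b k
    = (b 0 - b 1) ^+ 2 + (b 1 - b 2) ^+ 2 + (b 2 - b 0) ^+ 2.
  by rewrite /flux !sum3; ring.
by rewrite !addr_ge0 ?sqr_ge0.
Qed.

Lemma energy_eq0 b k l : \sum_k b k * flux b k = 0 -> b k = b l.
Proof.
have -> : \sum_k b k * flux b k
    = (b 0 - b 1) ^+ 2 + (b 1 - b 2) ^+ 2 + (b 2 - b 0) ^+ 2.
  by rewrite /flux !sum3; ring.
move/eqP; rewrite !paddr_eq0 ?addr_ge0 ?sqr_ge0 // !sqrf_eq0 !subr_eq0.
move=> /andP[/andP[/eqP e01 /eqP e12] /eqP e20].
by elim/I3_ind: k; elim/I3_ind: l; congruence.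
Qed.

Lemma flux_hext b c k :
  flux (hext r c b) k = \sum_l b l * flux (hv r c ^~ l) k.
Proof. by rewrite /flux /hext !sum3; ring. Qed.

(* Summation over the corners of V_1: interior contributions cancel in pairs. *)
Lemma junction_sum (B X : corner -> R) :
  (forall x, B (mate x) = B x) ->
  (forall x, ~~ bdry x -> X (mate x) = - X x) ->
  \sum_x B x * X x = \sum_l B (l, l, l) * X (l, l, l).
Proof.
move=> B_mate X_mate; rewrite (bigID bdry) /=.
have inner0 : \sum_(x | ~~ bdry x) B x * X x = 0.
  set s := \sum_(x | _) _.
  have : s = - s.
    rewrite {1}/s (reindex_inj (inv_inj mateK)) /= /s -sumrN.
    apply: eq_big => [x|x x_int]; first by rewrite bdry_mate.
    by rewrite bdry_mate in x_int; rewrite B_mate X_mate // mulrN.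
  by move=> sN; lra.
rewrite inner0 addr0 (reindex_onto (fun l => (l, l, l)) snd) /=.
  by apply: eq_bigl => l; rewrite !eqxx.
by move=> [[i j] k] /= /andP[/eqP-> /eqP->].
Qed.

(* A symbolic function U stands for u via U w k = u (F_w q_k). *)
Definition compat U :=
  (forall w k, U (rcons w (k, k)) k = U w k) /\
  (forall w x, U (rcons w (mate x).1) (mate x).2 = U (rcons w x.1) x.2).

Definition sh w U : sfun := fun w' => U (w ++ w').

Definition slin (y : R) U (z : R) V : sfun := fun w k => y * U w k + z * V w k.

(* Riemann sums for the integral of u h_b, with h_b the harmonic function with
   boundary values b; [moment U b] is that integral. *)
Fixpoint mom (m : nat) U b : R :=
  if m is m'.+1 then \sum_c msr r c * mom m' (sh [:: c] U) (hext r c b)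
  else (\sum_l b l * U [::] l) / 3.

Definition moment U b : R := limn (fun m => mom m U b).

(** What the arguments on words retain of integrability: moments exist in every cell. The class is
    stable under restriction, linear combination and relabelling. *)
Definition reg U := compat U /\
  forall w b, cvgn (fun m => mom m (sh w U) b).

(* With V the Laplacian of U: by Gauss-Green, the normal derivative at q_k. *)
Definition nd U V k : R := flux (U [::]) k + moment V (bvec k).

(* Up to a positive factor, the normal derivative of u at the corner x of the
   cells subdividing F_w SG; [Lap] asks that they cancel at every junction. *)
Definition junc U V w x : R := cnd r x.1 *
  (flux (U (rcons w x.1)) x.2
   + L r ^+ (size w).+1 * moment (sh (rcons w x.1) V) (bvec x.2)).

Definition Lap U V := forall w x, ~~ bdry x ->
  junc U V w (mate x) = - junc U V w x.

Lemma sh_sh w w' U : sh w (sh w' U) = sh (w' ++ w) U.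
Proof. by apply/funext => v; rewrite /sh catA. Qed.

Lemma hext_lin c (y z : R) b b' :
  hext r c (fun k => y * b k + z * b' k)
  = fun k => y * hext r c b k + z * hext r c b' k.
Proof. by apply/funext => k; rewrite /hext !sum3; ring. Qed.

Lemma mom_linb m U (y z : R) b b' :
  mom m U (fun k => y * b k + z * b' k) = y * mom m U b + z * mom m U b'.
Proof.
elim: m U b b' => [|m IH] U b b' /=; first by rewrite !sum3; ring.
rewrite !mulr_sumr -big_split /=; apply: eq_bigr => c _.
by rewrite hext_lin IH; ring.
Qed.

Lemma mom_bvec m U b : mom m U b = \sum_l b l * mom m U (bvec l).
Proof.
have {1}-> : b = fun k => 1 * (fun k => b 0 * bvec 0 k + b 1 * bvec 1 k) k
    + b 2 * bvec 2 k.
  by apply/funext; elim/I3_ind; rewrite /bvec ?eqxx ?I3E /=; ring.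
by rewrite !mom_linb sum3 mul1r.
Qed.

Lemma mom_linU m (y z : R) U V b :
  mom m (slin y U z V) b = y * mom m U b + z * mom m V b.
Proof.
elim: m U V b => [|m IH] U V b /=; first by rewrite /slin !sum3; ring.
rewrite !mulr_sumr -big_split /=; apply: eq_bigr => c _.
by rewrite [sh _ _](_ : _ = slin y (sh [:: c] U) z (sh [:: c] V)) // IH; ring.
Qed.

Lemma reg_sh w U : reg U -> reg (sh w U).
Proof.
move=> [[U1 U2] U3]; split; last by move=> w' b; rewrite sh_sh.
by split=> w' k; rewrite /sh -!rcons_cat ?U1 ?U2.
Qed.

Lemma reg_slin y U z V : reg U -> reg V -> reg (slin y U z V).
Proof.
move=> [[U1 U2] U3] [[V1 V2] V3]; split.
  by split=> w k; rewrite /slin ?U1 ?V1 ?U2 ?V2.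
move=> w b; under eq_fun do rewrite [sh _ _](_ : _ = slin y (sh w U) z (sh w V)) // mom_linU.
apply: (is_cvgD (is_cvgM (is_cvg_cst _) _) (is_cvgM (is_cvg_cst _) _)).
  exact: U3.
exact: V3.
Qed.

Lemma reg_cvg w U b : reg U -> cvgn (fun m => mom m (sh w U) b).
Proof. by case=> _; apply. Qed.
Arguments reg_cvg w {U} b _.

Lemma moment_cvg U b : reg U -> (fun m => mom m U b) @ \oo --> moment U b.
Proof. exact: (reg_cvg [::]). Qed.

Lemma moment_linU y U z V b : reg U -> reg V ->
  moment (slin y U z V) b = y * moment U b + z * moment V b.
Proof.
move=> rU rV; rewrite {1}/moment.
under eq_fun do rewrite mom_linU.
by apply/cvg_lim => //; apply: cvgD; apply: cvgM => //;
  first [exact: cvg_cst|exact: moment_cvg].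
Qed.

Lemma moment_bvec U b : reg U -> moment U b = \sum_l b l * moment U (bvec l).
Proof.
move=> rU; rewrite {1}/moment; under eq_fun do rewrite mom_bvec.
apply/cvg_lim => //; apply: (cvg_big add_continuous) => l _; apply: cvgM; first exact: cvg_cst.
exact: moment_cvg.
Qed.

Lemma moment_rec U b : reg U ->
  moment U b = \sum_c msr r c * moment (sh [:: c] U) (hext r c b).
Proof.
move=> rU; apply/cvg_lim => //; rewrite -(cvg_shiftS (fun m => mom m U b)) /=.
apply: (cvg_big add_continuous) => c _; apply: cvgM; first exact: cvg_cst.
by apply: moment_cvg; exact: reg_sh.
Qed.

Lemma moment_hv U c k : reg U ->
  moment U (hext r c (bvec k)) = \sum_l hv r c l k * moment U (bvec l).
Proof.
move=> rU; rewrite moment_bvec //; apply: eq_bigr => l _; congr (_ * _).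
rewrite /hext (bigD1 k) //= /bvec eqxx mulr1 big1 ?addr0 // => j /negbTE jk.
by rewrite jk mulr0.
Qed.

(* Reciprocity moves the flux onto [hv], whose own flux vanishes off V_0. *)
Lemma energy_restrict U k : compat U ->
  flux (U [::]) k
  = \sum_x hv r x.1 x.2 k * (cnd r x.1 * flux (U [:: x.1]) x.2).
Proof.
move=> [U1 U2].
transitivity (\sum_x U [:: x.1] x.2 * (cnd r x.1 * flux (hv r x.1 ^~ k) x.2)).
  rewrite (@junction_sum (fun x => U [:: x.1] x.2)
    (fun x => cnd r x.1 * flux (hv r x.1 ^~ k) x.2)).
  - transitivity (\sum_l U [::] l * flux (bvec k) l).
      rewrite -flux_sym (bigD1 k) //= /bvec eqxx mul1r big1 ?addr0 //.
      by move=> j /negbTE->; rewrite mul0r.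
    apply: eq_bigr => l _; rewrite flux_hv_bdry //; congr (_ * _).
    by rewrite -(U1 [::] l).
  - by move=> x; apply: (U2 [::]).
  - by move=> x x_int; rewrite (flux_hv_junction _ _ x_int) // opprK.
rewrite !big_corner; apply: eq_bigr => c _ /=.
have := flux_sym (U [:: c]) (hv r c ^~ k) => /(congr1 (fun t => cnd r c * t)).
rewrite !mulr_sumr => E.
transitivity (\sum_i cnd r c * (U [:: c] i * flux (hv r c ^~ k) i)).
  by apply: eq_bigr => i _; ring.
by rewrite E; apply: eq_bigr => i _; ring.
Qed.

(** Green's identity for h_k on V_1: the coarse normal derivative is the sum of h_k times [junc]
    over the corners of V_1. Interior corners cancel in pairs, as h_k has one value on both sides,
    and h_k vanishes at the other two boundary points. *)
Lemma nd_step U V k : reg U -> reg V -> Lap U V ->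
  nd U V k = junc U V [::] (k, k, k).
Proof.
move=> rU rV UV; rewrite /nd energy_restrict; last by case: rU.
rewrite moment_rec //.
(* [msrE] turns mass weights into conductances times [L r], so that flux and moment merge into
   [junc]. *)
have -> : \sum_c msr r c * moment (sh [:: c] V) (hext r c (bvec k))
    = \sum_x hv r x.1 x.2 k * (cnd r x.1 *
        (L r * moment (sh [:: x.1] V) (bvec x.2))).
  rewrite big_corner /=; apply: eq_bigr => c _; rewrite moment_hv; last exact: reg_sh.
  by rewrite mulr_sumr; apply: eq_bigr => l _; rewrite msrE //; ring.
rewrite -big_split /=.
transitivity (\sum_x hv r x.1 x.2 k * junc U V [::] x).
  by apply: eq_bigr => x _; rewrite /junc /= expr1; ring.
rewrite (@junction_sum (fun x => hv r x.1 x.2 k)).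
- rewrite (bigD1 k) //= hv_diag // eqxx mul1r big1 ?addr0 // => l lk.
  by rewrite hv_diag // (negbTE lk) mul0r.
- by move=> x; apply/esym/hv_mate.
- exact: UV.
Qed.

(** [slin y V 0 V] encodes the multiple of [V] by [y], so that the linearity lemmas for [slin] cover
    scaling too. *)
Lemma junc_sh w U V w' x : reg V ->
  junc (sh w U) (slin (L r ^+ size w) (sh w V) 0 (sh w V)) w' x
  = junc U V (w ++ w') x.
Proof.
move=> rV; rewrite /junc /= /sh -!rcons_cat.
have -> : (fun w0 => slin (L r ^+ size w) (fun w'0 => V (w ++ w'0)) 0
    (fun w'0 => V (w ++ w'0)) (rcons w' x.1 ++ w0))
    = slin (L r ^+ size w) (sh (rcons (w ++ w') x.1) V) 0
       (sh (rcons (w ++ w') x.1) V).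
  by apply/funext => v; apply/funext => k; rewrite /slin /sh !cat_rcons !catA.
rewrite moment_linU; try exact: reg_sh.
rewrite mul0r addr0 size_cat mulrA -exprD addSn addnC /sh.
by [].
Qed.

Lemma Lap_sh w U V : reg V -> Lap U V ->
  Lap (sh w U) (slin (L r ^+ size w) (sh w V) 0 (sh w V)).
Proof. by move=> rV UV w' x x_int; rewrite !junc_sh // UV. Qed.

Lemma junc_slin y z U V U' V' w x : reg V -> reg V' ->
  junc (slin y U z U') (slin y V z V') w x
  = y * junc U V w x + z * junc U' V' w x.
Proof.
move=> rV rV'; rewrite /junc {1}/slin flux_lin.
rewrite [sh _ _](_ : _ = slin y (sh (rcons w x.1) V) z (sh (rcons w x.1) V')) //.
by rewrite moment_linU; [ring|exact: reg_sh|exact: reg_sh].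
Qed.

Lemma Lap_slin y z U V U' V' : reg V -> reg V' -> Lap U V -> Lap U' V' ->
  Lap (slin y U z U') (slin y V z V').
Proof.
by move=> rV rV' UV UV' w x x_int; rewrite !junc_slin // UV // UV' //; ring.
Qed.

Lemma nd_slin y z U V U' V' k : reg V -> reg V' ->
  nd (slin y U z U') (slin y V z V') k = y * nd U V k + z * nd U' V' k.
Proof. by move=> rV rV'; rewrite /nd moment_linU // {1}/slin flux_lin; ring. Qed.

(** The integral of h_b is the mean of [b]; [sum_msr_hv] preserves it exactly under subdivision,
    which carries the induction. *)
Lemma mom_ge m U b (z : R) : (forall k, 0 <= b k) -> (forall w k, z <= U w k) ->
  z * (\sum_l b l) / 3 <= mom m U b.
Proof.
elim: m U b => [|m IH] U b b_ge0 z_le /=.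
  rewrite ler_pM2r ?invr_gt0 // mulr_sumr; apply: ler_sum => l _.
  by rewrite mulrC ler_wpM2l.
have hb_ge0 c k : 0 <= hext r c b k.
  by apply: sumr_ge0 => l _; rewrite mulr_ge0 ?hv_ge0.
have E : \sum_l b l = \sum_c msr r c * \sum_k hext r c b k.
  transitivity (\sum_l (\sum_c msr r c * \sum_k hv r c k l) * b l).
    by apply: eq_bigr => l _; rewrite sum_msr_hv // mul1r.
  under eq_bigr do rewrite mulr_suml.
  rewrite exchange_big; apply: eq_bigr => c _ /=.
  rewrite exchange_big /= mulr_sumr; apply: eq_bigr => l _.
  by rewrite -mulrA mulr_suml.
rewrite E mulr_sumr mulr_suml; apply: ler_sum => c _.
rewrite mulrCA -mulrA ler_wpM2l ?(ltW (msr_gt0 _ _)) //.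
by apply: IH => // w k; apply: z_le.
Qed.

Lemma bvec_ge0 l k : 0 <= bvec l k :> R.
Proof. by rewrite ler0n. Qed.

Lemma sum_bvec l : \sum_k bvec l k = 1 :> R.
Proof.
by rewrite (bigD1 l) //= /bvec eqxx big1 ?addr0 // => j /negbTE->.
Qed.

Lemma moment_ge U (z : R) k : reg U -> (forall w k, z <= U w k) ->
  z / 3 <= moment U (bvec k).
Proof.
move=> rU z_le; apply: limr_ge; first exact: (reg_cvg [::]).
apply: nearW => m; have := mom_ge m (bvec_ge0 k) z_le.
by rewrite sum_bvec mulr1.
Qed.

Lemma moment_le U (z : R) k : reg U -> (forall w k, U w k <= z) ->
  moment U (bvec k) <= z / 3.
Proof.
move=> rU le_z; have rV := reg_slin (-1) 0 rU rU.
have := @moment_ge _ (- z) k rV; rewrite moment_linU // mul0r addr0.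
rewrite mulN1r mulNr lerN2; apply => w l.
by rewrite /slin mul0r addr0 mulN1r lerN2.
Qed.

Lemma moment_eq0 U b : (forall w k, U w k = 0) -> moment U b = 0.
Proof.
move=> U0; rewrite /moment.
have E m : mom m U b = 0.
  elim: m U b U0 => [|m IH] U b U0 /=.
    by rewrite big1 ?mul0r // => l _; rewrite U0 mulr0.
  by rewrite big1 // => c _; rewrite IH ?mulr0 // => w k; apply: U0.
by under eq_fun do rewrite E; exact: lim_cst.
Qed.

(** The form in which uniform continuity survives on words; [Lap0_le0] uses it to find a small cell
    on which a function keeps its sign. *)
Definition scu U := forall e : R, 0 < e -> exists m, forall w, (m <= size w)%N ->
  forall w' k k', `|U (w ++ w') k - U w k'| <= e.

Lemma rcons_nseq (T : Type) m (y : T) : rcons (nseq m y) y = nseq m.+1 y.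
Proof. by rewrite -addn1 nseqD cats1. Qed.

Lemma compat_nseq U w k m : compat U -> U (w ++ nseq m (k, k)) k = U w k.
Proof.
move=> [U1 _]; elim: m => [|m IH]; first by rewrite cats0.
by rewrite -rcons_nseq -rcons_cat U1.
Qed.

(** Identifies the limit in the definition of the normal derivative with [nd]. Applying [nd_step] m
    times at q_k writes [nd] as the scaled flux at level m plus an integral term of order (L / r0)^m
    = mu0^m, which tends to 0 because V is bounded. *)
Lemma nd_limit U V k (z : R) : reg U -> reg V -> Lap U V ->
  (forall w l, `|V w l| <= z) ->
  (fun m => r0 r ^- m * flux (U (nseq m (k, k))) k) @ \oo --> nd U V k.
Proof.
move=> rU rV UV V_le.
pose W m := sh (nseq m (k, k)) V.
have rW m : reg (W m) by exact: reg_sh.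
have ndE m : nd U V k = r0 r ^- m * (flux (U (nseq m (k, k))) k
    + L r ^+ m * moment (W m) (bvec k)).
  elim: m => [|m IH]; first by rewrite expr0 invr1 !mul1r.
  rewrite {}IH; have := nd_step k (reg_sh (nseq m (k, k)) rU)
    (reg_slin (L r ^+ size (nseq m (k, k))) 0 (rW m) (rW m))
    (Lap_sh (nseq m (k, k)) rV UV).
  rewrite junc_sh // /nd moment_linU // mul0r addr0 size_nseq cats0 /sh cats0 => ->.
  rewrite /junc /= rcons_nseq size_nseq /cnd /= eqxx mulrA.
  by rewrite [r0 r ^+ _.+1]exprSr [(_ * r0 r)^-1]invfM.
have r0_gt0 : 0 < r0 r by have := cnd_gt0 (0, 0) r_gt0; rewrite /cnd /= invr_gt0.
have mu0E : L r / r0 r = mu0 r.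
  by have := msrE (0, 0) r_gt0; rewrite /msr /cnd /= => ->.
have mu0_lt1 : `|mu0 r| < 1.
  have r_pos := r_gt0; have : 0 < 3 * (2 * r + 1) by nra.
  by move=> d_gt0; rewrite /mu0 gtr0_norm ?invr_gt0 // invf_lt1 //; lra.
have -> : (fun m => r0 r ^- m * flux (U (nseq m (k, k))) k)
    = (fun m => nd U V k - mu0 r ^+ m * moment (W m) (bvec k)).
  apply/funext => m; rewrite (ndE m) -mu0E (expr_div_n (L r) (r0 r)).
  by rewrite mulrDr [_ ^- m * (_ * _)]mulrA [_ ^- m * L r ^+ m]mulrC addrK.
rewrite -[X in _ --> X]subr0; apply: cvgB; first exact: cvg_cst.
apply/norm_cvg0P; apply: (@squeeze_cvgr _ _ _ _ (fun=> 0)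
  (fun m => z / 3 * mu0 r ^+ m)); [|exact: cvg_cst|exact: cvg_geometric].
apply: nearW => m; rewrite normr_ge0 /= normrM mulrC.
have mu0_ge0 : 0 <= mu0 r ^+ m.
  by rewrite exprn_ge0 //; apply/ltW; have := msr_gt0 (0, 0) r_gt0.
rewrite (ger0_norm mu0_ge0) ler_wpM2r // ler_norml; apply/andP; split.
  rewrite -mulNr; apply: moment_ge => // w l.
  by have := V_le (nseq m (k, k) ++ w) l; rewrite ler_norml => /andP[].
apply: moment_le => // w l.
by have := V_le (nseq m (k, k) ++ w) l; rewrite ler_norml => /andP[].
Qed.

(* Summation by parts shows that the energy of B is zero. *)
Lemma harmonic_eq0 (B : corner -> R) :
  (forall x, B (mate x) = B x) -> (forall x, bdry x -> B x = 0) ->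
  (forall x, ~~ bdry x ->
     cnd r (mate x).1 * flux (fun k => B ((mate x).1, k)) (mate x).2
     = - (cnd r x.1 * flux (fun k => B (x.1, k)) x.2)) ->
  forall x, B x = 0.
Proof.
move=> B_mate B_bdry B_flux.
have := junction_sum B_mate B_flux.
rewrite [RHS]big1 => [|l _]; last by rewrite B_bdry ?mul0r //= !eqxx.
rewrite big_corner /= => E0.
have cell_energy c : \sum_k B (c, k) * flux (fun k => B (c, k)) k = 0.
  have E c' : \sum_k B (c', k) * (cnd r c' * flux (fun k => B (c', k)) k)
      = cnd r c' * \sum_k B (c', k) * flux (fun k => B (c', k)) k.
    by rewrite mulr_sumr; apply: eq_bigr => k _; ring.
  move: E0; under eq_bigr do rewrite E.
  move/eqP; rewrite psumr_eq0 => [|c' _]; last first.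
    by apply: mulr_ge0; [exact/ltW/cnd_gt0|exact: energy_ge0].
  move/allP/(_ c); rewrite mem_index_enum => /(_ isT) /=.
  by rewrite mulf_eq0 (gt_eqF (cnd_gt0 c r_gt0)) => /eqP.
have B_cell c k l : B (c, k) = B (c, l).
  exact: (@energy_eq0 (fun k => B (c, k))).
have B_diag i k : B (i, i, k) = 0.
  by rewrite (B_cell _ k i) B_bdry //= eqxx.
move=> [[i j] k]; rewrite (B_cell _ k i); have [<-|ij] := eqVneq i j.
  exact: B_diag.
by rewrite -B_mate /= eq_sym (negbTE ij) B_diag.
Qed.

(** [U] minus the harmonic extension of [U w] vanishes at the corners of the cell and, all moments
    of [V] being zero, has cancelling fluxes at the junctions: [harmonic_eq0] applies. *)
Lemma harmonic_hext U V w c : compat U -> Lap U V -> (forall w k, V w k = 0) ->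
  U (rcons w c) = hext r c (U w).
Proof.
move=> [U1 U2] UV V0; apply/funext => k; apply/eqP; rewrite -subr_eq0; apply/eqP.
apply: (harmonic_eq0 (B := fun x => U (rcons w x.1) x.2 - hext r x.1 (U w) x.2)
  _ _ _ (c, k)).
- by move=> x; rewrite U2 hext_mate.
- by move=> [[i j] l] /= /andP[/eqP-> /eqP->]; rewrite U1 hext_diag // subrr.
- move=> x x_int.
  have fluxB y : flux (fun k => U (rcons w y.1) k - hext r y.1 (U w) k) y.2
      = flux (U (rcons w y.1)) y.2 - flux (hext r y.1 (U w)) y.2.
    by rewrite /flux !sum3; ring.
  rewrite !fluxB !mulrBr; have := UV w x x_int.
  rewrite /junc !moment_eq0; try by move=> ? ?; exact: V0.
  rewrite !mulr0 !addr0 => ->.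
  suff -> : cnd r (mate x).1 * flux (hext r (mate x).1 (U w)) (mate x).2
    = - (cnd r x.1 * flux (hext r x.1 (U w)) x.2) by ring.
  rewrite !flux_hext !mulr_sumr -sumrN; apply: eq_bigr => l _.
  by rewrite mulrCA -[LHS]opprK -mulrN -(flux_hv_junction _ r_gt0 x_int); ring.
Qed.

(** If V were positive somewhere, all moments in a small cell there would be positive while the
    fluxes of the zero function vanish; every [junc] would be positive, and no two could cancel. *)
Lemma Lap0_le0 V w k : reg V -> scu V -> Lap (fun _ _ => 0) V -> V w k <= 0.
Proof.
move=> rV cV V_lap; rewrite leNgt; apply/negP => Vw_gt0.
have [|m Hm] := cV (V w k / 2); first by rewrite divr_gt0.
(* Zooming into the corner q_k keeps the value [V w k] ([compat_nseq]), while the cell becomes small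
   enough for V to stay above half of it. *)
pose w1 := w ++ nseq m (k, k).
have Vw1 : V w1 k = V w k by apply: compat_nseq; case: rV.
have V_ge w' l : V w k / 2 <= V (w1 ++ w') l.
  have : (m <= size w1)%N by rewrite size_cat size_nseq leq_addl.
  move=> /Hm /(_ w' l k); rewrite Vw1 ler_norml => /andP[+ _]; lra.
have M_gt0 c l : 0 < moment (sh (rcons w1 c) V) (bvec l).
  apply: (@lt_le_trans _ _ (V w k / 2 / 3)); first by rewrite !divr_gt0.
  by apply: moment_ge => [|w' j]; [exact: reg_sh|rewrite /sh cat_rcons].
have j_gt0 x : 0 < junc (fun _ _ => 0) V w1 x.
  rewrite /junc mulr_gt0 ?cnd_gt0 // ltr_wpDl ?mulr_gt0 ?exprn_gt0 ?L_gt0 //.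
  by rewrite /flux big1 // => j _; rewrite subrr.
have := V_lap w1 (0, 0, 1) isT => E.
have := j_gt0 (0, 0, 1); have := j_gt0 (mate (0, 0, 1)); rewrite E; lra.
Qed.

Lemma scu_slin y z U V : scu U -> scu V -> scu (slin y U z V).
Proof.
move=> cU cV e e_gt0.
pose d := e / 2 / (`|y| + `|z| + 1).
have s_gt0 : 0 < `|y| + `|z| + 1.
  by rewrite ltr_wpDl ?addr_ge0.
have d_gt0 : 0 < d by rewrite !divr_gt0.
have [m1 H1] := cU d d_gt0; have [m2 H2] := cV d d_gt0.
exists (maxn m1 m2) => w; rewrite geq_max => /andP[w1 w2] w' k k'.
have h1 := H1 w w1 w' k k'; have h2 := H2 w w2 w' k k'.
rewrite /slin [X in `|X|](_ : _ = y * (U (w ++ w') k - U w k')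
  + z * (V (w ++ w') k - V w k')); last by ring.
apply: (le_trans (ler_normD _ _)); rewrite !normrM.
apply: (@le_trans _ _ (`|y| * d + `|z| * d)).
  by apply: lerD; apply: ler_wpM2l.
have dE : d * (`|y| + `|z| + 1) = e / 2 by rewrite /d divfK // gt_eqF.
have : 0 <= e / 2 by rewrite divr_ge0 // ltW.
by move: dE => /[swap] _; nra.
Qed.

Lemma Lap_inj U V V' : reg U -> reg V -> reg V' -> scu V -> scu V' ->
  Lap U V -> Lap U V' -> V = V'.
Proof.
move=> rU rV rV' cV cV' UV UV'; apply/funext => w; apply/funext => k.
have le W W' : reg W -> reg W' -> scu W -> scu W' -> Lap U W -> Lap U W' ->
    W w k <= W' w k.
  move=> rW rW' cW cW' UW UW'.
  have := Lap_slin 1 (-1) rW rW' UW UW'.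
  rewrite [slin 1 U (-1) U](_ : _ = fun _ _ => 0); last first.
    by apply/funext => v; apply/funext => l; rewrite /slin; ring.
  move/(Lap0_le0 w k (reg_slin _ _ rW rW') (scu_slin _ _ cW cW')).
  by rewrite /slin; lra.
by apply/eqP; rewrite eq_le !le.
Qed.

(** * Relabelling of the three corners *)

Implicit Types s : {perm 'I_3}.

Definition perm_cell (s : {perm 'I_3}) c : cell := (s c.1, s c.2).
Definition perm_corner (s : {perm 'I_3}) x : corner := (perm_cell s x.1, s x.2).
Definition relabel (s : {perm 'I_3}) U : sfun :=
  fun w k => U (map (perm_cell s) w) (s k).

Lemma perm_cell_inj s : injective (perm_cell s).
Proof. by move=> [i j] [i' j'] [/perm_inj-> /perm_inj->]. Qed.

Lemma mate_perm s x : mate (perm_corner s x) = perm_corner s (mate x).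
Proof.
by case: x => [[i j] k]; rewrite /= (inj_eq perm_inj); case: ifP.
Qed.

Lemma bdry_perm s x : bdry (perm_corner s x) = bdry x.
Proof. by case: x => [[i j] k]; rewrite /= !(inj_eq perm_inj). Qed.

Lemma relabel_rcons s U w c k :
  relabel s U (rcons w c) k = U (rcons (map (perm_cell s) w) (perm_cell s c)) (s k).
Proof. by rewrite /relabel map_rcons. Qed.

Lemma compat_relabel s U : compat U -> compat (relabel s U).
Proof.
move=> [U1 U2]; split => [w k|w x]; rewrite !relabel_rcons ?U1 //.
by have := U2 (map (perm_cell s) w) (perm_corner s x); rewrite mate_perm.
Qed.

Lemma sh_relabel s w U : sh w (relabel s U) = relabel s (sh (map (perm_cell s) w) U).
Proof.
by apply/funext => v; apply/funext => k; rewrite /sh /relabel map_cat.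
Qed.

Lemma hext_perm s c b : hext r c (b \o s) = hext r (perm_cell s c) b \o s.
Proof.
apply/funext => k; rewrite /hext /= [RHS](reindex_inj (@perm_inj _ s)) /=.
apply: eq_bigr => l _; congr (_ * _).
exact/esym/(hv_perm r c k l (@perm_inj _ s)).
Qed.

Lemma mom_relabel s m U b : mom m (relabel s U) (b \o s) = mom m U b.
Proof.
elim: m U b => [|m IH] U b /=.
  by congr (_ / _); rewrite [RHS](reindex_inj (@perm_inj _ s)).
rewrite [RHS](reindex_inj (@perm_cell_inj s)) /=; apply: eq_bigr => c _.
rewrite sh_relabel hext_perm IH; congr (_ * _).
by rewrite /msr /= (inj_eq perm_inj).
Qed.

Lemma bvec_perm s k : bvec k = bvec (s k) \o s :> vec.
Proof. by apply/funext => l; rewrite /bvec /= (inj_eq perm_inj). Qed.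

Lemma moment_relabel s U k : moment (relabel s U) (bvec k) = moment U (bvec (s k)).
Proof.
by rewrite /moment (bvec_perm s); under eq_fun do rewrite mom_relabel.
Qed.

Lemma reg_relabel s U : reg U -> reg (relabel s U).
Proof.
move=> [U1 U2]; split; first exact: compat_relabel.
move=> w b; rewrite sh_relabel.
have -> : b = (b \o (s^-1)%g) \o s by apply/funext => l; rewrite /= permK.
by under eq_fun do rewrite mom_relabel; exact: U2.
Qed.

Lemma flux_perm s b k : flux (fun l => b (s l)) k = flux b (s k).
Proof. by rewrite /flux [RHS](reindex_inj (@perm_inj _ s)). Qed.

Lemma nd_relabel s U V k : nd (relabel s U) (relabel s V) k = nd U V (s k).
Proof. by rewrite /nd moment_relabel /relabel flux_perm. Qed.

Lemma junc_relabel s U V w x : junc (relabel s U) (relabel s V) w x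
  = junc U V (map (perm_cell s) w) (perm_corner s x).
Proof.
rewrite /junc sh_relabel moment_relabel size_map map_rcons.
rewrite [X in flux X](_ : _ = fun k =>
  U (rcons (map (perm_cell s) w) (perm_cell s x.1)) (s k)); last first.
  by apply/funext => k; rewrite relabel_rcons.
by rewrite flux_perm /cnd /= (inj_eq perm_inj).
Qed.

Lemma Lap_relabel s U V : Lap U V -> Lap (relabel s U) (relabel s V).
Proof.
by move=> UV w x x_int; rewrite !junc_relabel -mate_perm UV ?bdry_perm.
Qed.

(** * Jets at q_0 and chains of iterated Laplacians *)

Definition tang U (m : nat) : R := lambda_skew r ^- m *
  (U (nseq m (0, 0)) 1 - U (nseq m (0, 0)) 2).

(** Zero flux at q_0 makes the boundary values z, z + t, z - t. The skew part is an eigenvector of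
    restriction to the corner cell, with eigenvalue [lambda_skew r]; hence [tang] is the constant
    2t, and its limit forces t = 0. *)
Lemma harmonic_flat U : (forall w c, U (rcons w c) = hext r c (U w)) ->
  flux (U [::]) 0 = 0 -> tang U @ \oo --> (0 : R) ->
  forall w k, U w k = U [::] 0.
Proof.
move=> U_hext flux0 tang0; pose z := U [::] 0; pose t := U [::] 1 - z.
have r_pos := r_gt0.
have skew_gt0 : 0 < lambda_skew r.
  by rewrite /lambda_skew divr_gt0 ?mulr_gt0 ?Dpoly_gt0.
have U2E : U [::] 2 = z - t.
  by move: flux0; rewrite /flux sum3 /t /z; lra.
have powE m : U (nseq m (0, 0)) = fun k =>
    z + lambda_skew r ^+ m * t * (bvec 1 k - bvec 2 k).
  elim: m => [|m IH].
    apply/funext; elim/I3_ind; rewrite /bvec ?eqxx ?I3E /= ?U2E /t /z; ring.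
  rewrite -rcons_nseq U_hext IH; apply/funext => k.
  have h0 : hv r (0, 0) 0 1 = 0 by rewrite hv_diag.
  have h0' : hv r (0, 0) 0 2 = 0 by rewrite hv_diag.
  have h1 := hv_skew r_gt0.
  have h2 : hv r (0, 0) 2 1 = hv r (0, 0) 1 2.
    by rewrite /hv /hnum /= ?eqxx ?I3E.
  have h3 : hv r (0, 0) 2 2 = hv r (0, 0) 1 1.
    by rewrite /hv /hnum /= ?eqxx ?I3E.
  have sum1 := sum_hv (0, 0) k r_gt0; rewrite sum3 in sum1.
  rewrite /hext sum3 exprSr /bvec ?eqxx ?I3E /=.
  transitivity (z * (hv r (0, 0) k 0 + hv r (0, 0) k 1 + hv r (0, 0) k 2)
    + lambda_skew r ^+ m * t * (hv r (0, 0) k 1 - hv r (0, 0) k 2)); first by ring.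
  rewrite sum1 -h1; clear sum1; elim/I3_ind: k; rewrite ?eqxx ?I3E /=.
  - by rewrite h0 h0'; ring.
  - by ring.
  - by rewrite h2 h3; ring.
have t0 : t = 0.
  have tangE : tang U = fun=> 2 * t.
    apply/funext => m; rewrite /tang powE /bvec ?eqxx ?I3E /=.
    rewrite [X in _ * X](_ : _ = lambda_skew r ^+ m * (2 * t)); last by ring.
    by rewrite mulKf // expf_neq0 // gt_eqF.
  have : 2 * t = 0.
    by apply: (cvg_unique _ _ tang0) => //; rewrite tangE; exact: cvg_cst.
  by lra.
elim/last_ind => [|w c IH] k; last first.
  rewrite U_hext -[RHS](hext_cst c (U [::] 0) k r_gt0).
  by congr (hext r c _ k); apply/funext => l; exact: IH.
by have /(congr1 (@^~ k)) := powE 0%N; rewrite /= t0 mulr0 mul0r addr0.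
Qed.

(** [V l] plays the role of the Laplacian of order [l] of [V 0]; vanishing from some order on
    encodes being a polynomial. *)
Definition chain (V : nat -> sfun) :=
  [/\ forall l, reg (V l), forall l, Lap (V l) (V l.+1)
    & exists n, forall l, (n <= l)%N -> V l = fun _ _ => 0].

(* The Taylor data at q_0 of such a chain reduce to the values V l [::] 0. *)
Definition flat_chain (V : nat -> sfun) := chain V /\
  forall l, nd (V l) (V l.+1) 0 = 0 /\ tang (V l) @ \oo --> (0 : R).

Lemma flat_chain_eq0 (V : nat -> sfun) : flat_chain V -> (forall l, V l [::] 0 = 0) ->
  forall l, V l = fun _ _ => 0.
Proof.
move=> [[rV lapV [n V_eq0]] flatV] V0 l.
suff H d : forall l, (n <= l + d)%N -> V l = fun _ _ => 0.
  by apply: (H n); rewrite leq_addl.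
elim: d => [|d IH] {}l; first by rewrite addn0; exact: V_eq0.
rewrite -addSnnS => /IH VS0; apply/funext => w; apply/funext => k.
have [nd0 tang0] := flatV l; rewrite -(V0 l).
apply: harmonic_flat => [{}w c||//].
  apply: (harmonic_hext (V := V l.+1)) => //; first by case: (rV l).
  by move=> v j; rewrite VS0.
by move: nd0; rewrite /nd moment_eq0 ?addr0 // => v j; rewrite VS0.
Qed.

Lemma chain_slin y z (V W : nat -> sfun) : chain V -> chain W ->
  chain (fun l => slin y (V l) z (W l)).
Proof.
move=> [rV lV [n Vn]] [rW lW [m Wm]]; split.
- by move=> l; exact: reg_slin.
- by move=> l; exact: Lap_slin.
- exists (maxn n m) => l; rewrite geq_max => /andP[nl ml].
  rewrite Vn // Wm //; apply/funext => w; apply/funext => k.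
  by rewrite /slin !mulr0 addr0.
Qed.

Lemma tang_slin y z U V m : tang (slin y U z V) m = y * tang U m + z * tang V m.
Proof. by rewrite /tang /slin; move: (_ ^- m) => g; ring. Qed.

Lemma flat_slin y z (V W : nat -> sfun) : flat_chain V -> flat_chain W ->
  flat_chain (fun l => slin y (V l) z (W l)).
Proof.
move=> [cV fV] [cW fW]; split; first exact: chain_slin.
move=> l; have [nV tV] := fV l; have [nW tW] := fW l.
case: cV cW => [rV _ _] [rW _ _]; rewrite nd_slin // nV nW; split; first by ring.
rewrite [tang _](_ : _ = fun m => y * tang (V l) m + z * tang (W l) m); last first.
  by apply/funext => m; exact: tang_slin.
have -> : 0 = y * 0 + z * 0 :> R by ring.
by apply: cvgD; apply: cvgM => //; exact: cvg_cst.
Qed.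

Lemma chain_shift n (V : nat -> sfun) : chain V -> chain (fun l => V (n + l)%N).
Proof.
move=> [rV lV [m Vm]]; split=> [//|l|]; first by rewrite addnS.
by exists m => l ml; apply: Vm; rewrite (leq_trans ml) // leq_addl.
Qed.

Lemma flat_shift n (V : nat -> sfun) : flat_chain V -> flat_chain (fun l => V (n + l)%N).
Proof.
move=> [cV fV]; split; first exact: chain_shift.
by move=> l; rewrite addnS; exact: fV.
Qed.

(** Each Laplacian of a restriction to a first-level cell costs one factor [L r], whence the power
    at order [l]. *)
Definition cell_chain c (V : nat -> sfun) (l : nat) : sfun :=
  slin (L r ^+ l) (sh [:: c] (V l)) 0 (sh [:: c] (V l)).

Lemma chain_cell c (V : nat -> sfun) : chain V -> chain (cell_chain c V).
Proof.
move=> [rV lV [m Vm]]; have rsV l : reg (sh [:: c] (V l)) by exact: reg_sh.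
split=> [l|l|]; first exact: reg_slin.
- have := Lap_sh [:: c] (rV l.+1) (lV l).
  move=> /(fun h => Lap_slin (L r ^+ l) 0 _ _ h h) => /(_ (reg_slin _ _ _ _)) H.
  have {}H := H (rsV _) (rsV _) (reg_slin _ _ (rsV _) (rsV _)).
  rewrite /cell_chain [X in Lap _ X](_ : _ = slin (L r ^+ l)
    (slin (L r ^+ size [:: c]) (sh [:: c] (V l.+1)) 0 (sh [:: c] (V l.+1))) 0
    (slin (L r ^+ size [:: c]) (sh [:: c] (V l.+1)) 0 (sh [:: c] (V l.+1)))) //.
  by apply/funext => w; apply/funext => k; rewrite /slin /= exprSr; ring.
- exists m => l /Vm Vl; apply/funext => w; apply/funext => k.
  by rewrite /cell_chain /slin /sh Vl !mulr0 addr0.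
Qed.

Lemma nd_cell c (V : nat -> sfun) l k : chain V ->
  cnd r c * nd (cell_chain c V l) (cell_chain c V l.+1) k
  = L r ^+ l * junc (V l) (V l.+1) [::] (c, k).
Proof.
move=> [rV _ _]; rewrite /nd moment_linU; try exact: reg_sh.
rewrite {1}/cell_chain {1}/slin flux_lin /junc /= /sh /= exprSr expr1; ring.
Qed.

Lemma chain_relabel s (V : nat -> sfun) : chain V -> chain (fun l => relabel s (V l)).
Proof.
move=> [rV lV [m Vm]]; split=> [l|l|]; first exact: reg_relabel.
  exact: Lap_relabel.
by exists m => l /Vm ->.
Qed.

Definition tau : {perm 'I_3} := tperm 1 2.

Lemma tauE : (tau 0 = 0) * (tau 1 = 2) * (tau 2 = 1).
Proof. by rewrite /tau tpermL tpermR tpermD. Qed.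

Lemma tang_tau U m : tang (relabel tau U) m = - tang U m.
Proof.
rewrite /tang /relabel map_nseq /perm_cell /= !tauE.
by rewrite -mulrN opprB.
Qed.

Lemma flat_tau (V : nat -> sfun) : flat_chain V -> flat_chain (fun l => relabel tau (V l)).
Proof.
move=> [cV fV]; split; first exact: chain_relabel.
move=> l; have [nV tV] := fV l; rewrite nd_relabel tauE; split => //.
rewrite [tang _](_ : _ = fun m => - tang (V l) m); last first.
  by apply/funext => m; exact: tang_tau.
by rewrite -oppr0; exact: cvgN.
Qed.

(** * Expansion in monomials at q_0 *)

Section Expansion.
Variable P : nat -> nat -> sfun.
Hypothesis flatP : forall j, flat_chain (P j).
Hypothesis P_jet : forall j l, P j l [::] 0 = (j == l)%:R.

Lemma flat_sum n (y : nat -> R) :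
  flat_chain (fun l w k => \sum_(i < n) y i * P i l w k).
Proof.
elim: n => [|n IH].
  rewrite (_ : (fun _ _ _ => _) = fun l => slin 0 (P 0 l) 0 (P 0 l)).
    exact: flat_slin.
  apply/funext => l; apply/funext => w; apply/funext => k.
  by rewrite big_ord0 /slin !mul0r addr0.
have := flat_slin 1 (y n) IH (flatP n); congr flat_chain.
apply/funext => l; apply/funext => w; apply/funext => k.
by rewrite big_ord_recr /= /slin mul1r.
Qed.

Lemma flat_expand n (V : nat -> sfun) : flat_chain V -> (forall l, (n <= l)%N -> V l [::] 0 = 0) ->
  forall w k, V 0%N w k = \sum_(i < n) V i [::] 0 * P i 0%N w k.
Proof.
move=> fV Vn w k.
have fW := flat_slin 1 (-1) fV (flat_sum n (fun i => V i [::] 0)).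
have W0 := flat_chain_eq0 fW.
suff jet0 l : V l [::] 0 = \sum_(i < n) V i [::] 0 * P i l [::] 0.
  have /W0/(_ 0%N)/(congr1 (fun g : sfun => g w k)) : forall l,
      slin 1 (V l) (-1) (fun w k => \sum_(i < n) V i [::] 0 * P i l w k) [::] 0 = 0.
    by move=> l; rewrite /slin -jet0 mulN1r mul1r subrr.
  by rewrite /slin mul1r mulN1r => /eqP; rewrite subr_eq0 => /eqP.
have [ln|nl] := ltnP l n; last first.
  rewrite Vn // big1 // => i _; rewrite P_jet ltn_eqF ?mulr0 //.
  exact: leq_trans (ltn_ord i) nl.
rewrite (bigD1 (Ordinal ln)) //= P_jet eqxx mulr1 big1 ?addr0 // => i il.
by rewrite P_jet (_ : (_ == _) = false) ?mulr0 //; apply/negbTE.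
Qed.

(** The shifted chain is flat and its only possible nonzero value at q_0 is at order [j - l], so its
    expansion has at most one term. *)
Lemma P_lap j l w k : P j l w k = if (l <= j)%N then P (j - l) 0%N w k else 0.
Proof.
have := flat_expand (n := j.+1) (flat_shift l (flatP j)).
rewrite addn0 => -> => [|i ji]; last first.
  by rewrite P_jet ltn_eqF // (leq_trans ji) // leq_addl.
under eq_bigr do rewrite P_jet.
case: leqP => lj; last first.
  rewrite big1 // => i _; rewrite ltn_eqF ?mul0r //.
  by rewrite (leq_trans lj) // leq_addr.
have lt : (j - l < j.+1)%N by rewrite ltnS leq_subr.
rewrite (bigD1 (Ordinal lt)) //= subnKC // eqxx mul1r big1 ?addr0 // => i il.
rewrite (_ : (_ == _) = false) ?mul0r //; apply/negbTE; apply: contra il => /eqP jE.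
by apply/eqP/val_inj; rewrite /= [in RHS]jE addKn.
Qed.

Lemma P0_eq1 w k : P 0 0%N w k = 1.
Proof.
have [[rP lP _] fP] := flatP 0; have [nd0 tang0] := fP 0%N.
have P01 v l : P 0 1%N v l = 0 by rewrite P_lap.
have P00 : P 0 0%N [::] 0 = 1 by rewrite P_jet.
rewrite -P00; apply: harmonic_flat => [v c||//].
  by apply: (harmonic_hext (V := P 0 1%N)) => //; case: (rP 0%N).
by move: nd0; rewrite /nd moment_eq0 // addr0.
Qed.

(** Reflection preserves flatness and the values at q_0, so the reflected chain has the expansion of
    [P j] itself. *)
Lemma P_tau j w k : P j 0%N (map (perm_cell tau) w) (tau k) = P j 0%N w k.
Proof.
rewrite -/(relabel tau (P j 0%N) w k).
rewrite (flat_expand (n := j.+1) (flat_tau (flatP j))) => [|l jl]; last first.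
  by rewrite /relabel /= tauE P_jet ltn_eqF.
  rewrite (bigD1 ord_max) //= big1 ?addr0 => [|i ij].
    by rewrite /relabel /= tauE P_jet eqxx mul1r.
  rewrite /relabel /= tauE P_jet (_ : (_ == _) = false) ?mul0r //; apply/negbTE.
  by apply: contra ij => /eqP ji; apply/eqP/val_inj.
Qed.

(** The restriction to the corner cell at q_0 is flat again: [nd_step] transfers the normal
    derivative, and the tangential quotients are those of [P j] with the index shifted by one, up to
    a factor. Its values at q_0 are [L r ^+ j] times those of [P j]. *)
Lemma P_corner j w k : P j 0%N ((0, 0) :: w) k = L r ^+ j * P j 0%N w k.
Proof.
have cP l : compat (P j l) by case: (flatP j) => [[rP _ _] _]; case: (rP l).
have jet l : cell_chain (0, 0) (P j) l [::] 0 = L r ^+ l * (j == l)%:R.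
  rewrite /cell_chain /slin mul0r addr0 /sh /= -P_jet.
  by congr (_ * _); have [+ _] := cP l; move=> /(_ [::] 0).
have fC : flat_chain (cell_chain (0, 0) (P j)).
  have [cj fj] := flatP j; split; first exact: chain_cell.
  move=> l; have [nd0 tang0] := fj l; split.
    have := nd_cell (0, 0) l 0 cj; case: cj => rj lj _.
    rewrite -nd_step // nd0 mulr0 => /eqP; rewrite mulf_eq0.
    by rewrite (gt_eqF (cnd_gt0 _ r_gt0)) => /eqP.
  have r_pos := r_gt0.
  have skew_gt0 : 0 < lambda_skew r.
    by rewrite /lambda_skew divr_gt0 ?mulr_gt0 ?Dpoly_gt0.
  rewrite [tang _](_ : _ = fun m => L r ^+ l * lambda_skew r * tang (P j l) m.+1).
    rewrite -(mulr0 (L r ^+ l * lambda_skew r)); apply: cvgM; first exact: cvg_cst.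
    by rewrite (cvg_shiftS (tang (P j l))).
  apply/funext => m; rewrite /cell_chain tang_slin mul0r addr0 /tang /sh /=.
  rewrite -mulrA; congr (_ * _); rewrite mulrA; congr (_ * _).
  by rewrite exprS [(lambda_skew r * _)^-1]invfM mulrA mulfV ?mul1r // gt_eqF.
transitivity (cell_chain (0, 0) (P j) 0%N w k).
  by rewrite /cell_chain /slin expr0 mul1r mul0r addr0.
rewrite (flat_expand (n := j.+1) fC) => [|l jl]; last first.
  by rewrite jet ltn_eqF // mulr0.
rewrite (bigD1 ord_max) //= big1 ?addr0 => [|i ij]; first by rewrite jet eqxx mulr1.
rewrite jet (_ : (_ == _) = false) ?mulr0 ?mul0r //; apply/negbTE.
by apply: contra ij => /eqP ji; apply/eqP/val_inj.
Qed.

(** The two neighbours of [x] in its cell. This is the value at q_1 of the restriction to that cell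
    after moving [x] to q_0 and adding the mirror image under q_1 <-> q_2. *)
Definition star U x := \sum_k U [:: x.1] k - U [:: x.1] x.2.

Lemma starE U x : star U x = U [:: x.1] (1 + x.2) + U [:: x.1] (2 + x.2).
Proof.
have E22 : (2 + 2 : 'I_3) = 1 by exact: val_inj.
have E12 : (1 + 2 : 'I_3) = 0 by exact: val_inj.
rewrite /star sum3; case: x => c k /=; move: (U [:: c]) => b.
by elim/I3_ind: k; rewrite ?addr0 ?E22 ?E12 ?I3E; lra.
Qed.

(* The average over the two cells at an interior junction, moved to q_0 and
   symmetrized, is a chain with trivial normal and tangential data. *)
Lemma P_junction j x : ~~ bdry x ->
  cnd r x.1 * star (P j 0%N) x + cnd r (mate x).1 * star (P j 0%N) (mate x)
  = 2 * (cnd r x.1 + cnd r (mate x).1) *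
    \sum_(i < j.+1) L r ^+ i * P i 0%N [::] 1 * P (j - i) 0%N [:: x.1] x.2.
Proof.
move=> x_int; have [cj _] := flatP j; have [rj lj _] := cj.
(* Translation modulo 3 by the index of the corner: after relabelling, the value at q_0 is the value
   at [y]. *)
pose rot (y : corner) : {perm 'I_3} := perm (addIr y.2).
pose W (y : corner) l := relabel (rot y) (cell_chain y.1 (P j) l).
pose Z y l := slin 1 (W y l) 1 (relabel tau (W y l)).
pose V l := slin (cnd r x.1) (Z x l) (cnd r (mate x).1) (Z (mate x) l).
have cW y : chain (W y) by exact/chain_relabel/chain_cell.
have cZ y : chain (Z y) by exact/chain_slin/chain_relabel.
have rW y l : reg (W y l) by case: (cW y).
have rtW y l : reg (relabel tau (W y l)) by exact: reg_relabel.
have rZ y l : reg (Z y l) by case: (cZ y).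
have ndZ y l : cnd r y.1 * nd (Z y l) (Z y l.+1) 0
    = 2 * (L r ^+ l * junc (P j l) (P j l.+1) [::] y).
  rewrite nd_slin // nd_relabel tauE !nd_relabel permE add0r mul1r.
  by rewrite mulrDr nd_cell //; case: y => [? ?] /=; ring.
have fV : flat_chain V.
  split; first exact: chain_slin.
  (* The weighted normal derivatives add up to a multiple of the sum of the two [junc], zero by
     [Lap]; the tangential quotients vanish at every level by symmetrization. *)
  move=> l; split.
    by rewrite nd_slin // !ndZ lj //; ring.
  rewrite [tang _](_ : _ = fun=> 0); first exact: cvg_cst.
  apply/funext => m; rewrite /V (tang_slin (cnd r x.1)) /Z.
  by rewrite !(tang_slin 1 1) !tang_tau; ring.
have Z0 y l : Z y l [::] 0 = 2 * (L r ^+ l * P j l [:: y.1] y.2).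
  rewrite /Z /W /rot /slin /relabel /= tauE permE add0r /cell_chain /slin /sh /=; ring.
have Z1 y : Z y 0%N [::] 1 = star (P j 0%N) y.
  rewrite starE /Z /W /rot /slin /relabel /= tauE !permE /cell_chain /slin /sh /=.
  rewrite expr0 !mul1r !mul0r !addr0. congr (_ + P j 0%N _ _).
have P2 l : P j l [:: (mate x).1] (mate x).2 = P j l [:: x.1] x.2.
  by have [[_ H] _] := rj l; exact: (H [::] x).
have V0 l : V l [::] 0
    = 2 * (cnd r x.1 + cnd r (mate x).1) * (L r ^+ l * P j l [:: x.1] x.2).
  by rewrite {1}/V {1}/slin !Z0 P2; ring.
have Vj l : (j.+1 <= l)%N -> V l [::] 0 = 0.
  by move=> jl; rewrite V0 P_lap leqNgt jl /= !mulr0.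
have := flat_expand fV Vj [::] 1.
rewrite {1}/V {1}/slin !Z1 => ->; rewrite mulr_sumr; apply: eq_bigr => i _.
by rewrite V0 P_lap -ltnS ltn_ord; ring.
Qed.

(** The Laplacian of P_1 is 1 and h_0 has integral 1/3, so the normal derivative of P_1 at q_0 is -2
    alpha_1 + 1/3, and it is zero. *)
Lemma P1_mean : P 1 0%N [::] 1 = 6^-1.
Proof.
have [[rP _ _] fP] := flatP 1; have [+ _] := fP 0%N.
have P11 w k : P 1 1%N w k = 1 by rewrite P_lap P0_eq1.
have mom1 : moment (P 1 1%N) (bvec 0) = 1 / 3.
  apply/eqP; rewrite eq_le moment_le ?moment_ge // => w k; by rewrite P11.
rewrite /nd mom1 /flux sum3 P_jet.
have -> : P 1 0%N [::] 2 = P 1 0%N [::] 1.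
  by have := P_tau 1 [::] 1; rewrite /= tauE.
by rewrite /= => E; apply: (mulfI (x := 6)) => //; rewrite mulfV //; lra.
Qed.

End Expansion.

End Symbolic.

(** * Geometry of the gasket *)

Section Geometry.
Context {R : realType} (q : 'I_3 -> plane R).
Hypothesis q_triangle : is_triangle q.
Implicit Types (x y : plane R) (k l i j : 'I_3) (c : cell) (w : seq cell).

Let det := ((q 1).1 - (q 0).1) * ((q 2).2 - (q 0).2)
           - ((q 1).2 - (q 0).2) * ((q 2).1 - (q 0).1).

Let det_neq0 : det != 0.
Proof. by rewrite subr_eq0; exact: q_triangle. Qed.

(** Barycentric coordinates relative to the q_k, as quotients of signed areas. *)
Definition bary k x : R :=
  (((q (k + 1)).1 - x.1) * ((q (k - 1)).2 - x.2)
   - ((q (k + 1)).2 - x.2) * ((q (k - 1)).1 - x.1)) / det.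

Lemma bary_sum x : \sum_k bary k x = 1.
Proof.
rewrite sum3 /bary !I3E; move: det_neq0; rewrite /det => d0.
by field.
Qed.

Lemma bary_q k l : bary k (q l) = (k == l)%:R.
Proof.
rewrite /bary; move: det_neq0; rewrite /det => d0.
by elim/I3_ind: k; elim/I3_ind: l; rewrite ?eqxx ?I3E ?mulr1n ?mulr0n; field.
Qed.

Lemma F1_fst i x : (F1 q i x).1 = (x.1 + (q i).1) / 2.
Proof. by rewrite /F1 /= /GRing.scale /=; field. Qed.

Lemma F1_snd i x : (F1 q i x).2 = (x.2 + (q i).2) / 2.
Proof. by rewrite /F1 /= /GRing.scale /=; field. Qed.

Lemma bary_F1 k i x : bary k (F1 q i x) = (bary k x + (k == i)%:R) / 2.
Proof.
rewrite -bary_q /bary F1_fst F1_snd; move: det_neq0; rewrite /det => d0.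
by elim/I3_ind: k; elim/I3_ind: i; rewrite ?I3E; field.
Qed.

Lemma bary_F k i j x :
  bary k (F q i j x) = bary k x / 4 + (k == j)%:R / 4 + (k == i)%:R / 2.
Proof. by rewrite /F !bary_F1; field. Qed.

Lemma bary_inj x y : (forall k, bary k x = bary k y) -> x = y.
Proof.
have comb z : z = (\sum_k bary k z * (q k).1, \sum_k bary k z * (q k).2).
  rewrite [LHS]surjective_pairing !sum3 /bary !I3E.
  by move: det_neq0; rewrite /det => d0; congr pair; field.
by move=> xy; rewrite [x]comb [y]comb; under eq_bigr do rewrite xy;
  under [X in (_, X)]eq_bigr do rewrite xy.
Qed.

Lemma F1_q i : F1 q i (q i) = q i.
Proof. by rewrite /F1 subrr scaler0 add0r. Qed.

Lemma F_q i : F q i i (q i) = q i.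
Proof. by rewrite /F !F1_q. Qed.

Lemma F1_swap i j : F1 q i (q j) = F1 q j (q i).
Proof.
by apply: bary_inj => k; rewrite !bary_F1 !bary_q addrC.
Qed.

Notation Fc c := (F q c.1 c.2).

Lemma F_mate (x : corner) : Fc (mate x).1 (q (mate x).2) = Fc x.1 (q x.2).
Proof.
case: x => [[i j] k] /=; rewrite /F; have [->|jk] := eqVneq j k => /=.
  by rewrite !F1_q F1_swap.
by rewrite F1_swap.
Qed.

Lemma F_dist i j x y : `|F q i j x - F q i j y| = `|x - y| / 4.
Proof.
have F1D l z t : F1 q l z - F1 q l t = 2^-1 *: (z - t).
  by rewrite /F1 opprD addrACA subrr addr0 -scalerBr opprB addrA subrK.
by rewrite /F !F1D !normrZ !gtr0_norm ?invr_gt0 //; lra.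
Qed.

Lemma Fw_cat w w' x : Fw q (w ++ w') x = Fw q w (Fw q w' x).
Proof. by rewrite /Fw foldr_cat. Qed.

Lemma Fw_dist w x y : `|Fw q w x - Fw q w y| = `|x - y| / 4 ^+ size w.
Proof.
elim: w => [|c w IH] /=; first by rewrite expr0 divr1.
by rewrite F_dist IH exprSr invfM mulrA.
Qed.

Lemma Fw_continuous w : continuous (Fw q w).
Proof.
move=> y; apply/cvgrPdist_lt => d d_gt0.
near=> z; rewrite Fw_dist; apply: (@le_lt_trans _ _ `|y - z|).
  by rewrite ler_pdivrMr ?exprn_gt0 // ler_peMr // exprn_ege1 // ler1n.
by near: z; apply: cvgr_dist_lt.
Unshelve. all: by end_near.
Qed.

Variable K : set (plane R).
Hypothesis K_gasket : is_gasket q K.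

Lemma K_neq0 : K !=set0. Proof. by case: K_gasket. Qed.

Lemma K_compact : compact K. Proof. by case: K_gasket. Qed.

Lemma K_closed : closed K.
Proof. by apply: compact_closed; [exact: norm_hausdorff|exact: K_compact]. Qed.

Lemma F_K c x : K x -> K (Fc c x).
Proof.
by move=> Kx; case: K_gasket => _ _ ->; exists c => //; exists x.
Qed.

Lemma K_cell x : K x -> exists c y, K y /\ Fc c y = x.
Proof.
case: K_gasket => _ _ KE; rewrite {1}KE => -[c _ [y Ky <-]].
by exists c, y.
Qed.

Lemma Fw_K w x : K x -> K (Fw q w x).
Proof. by move=> Kx; elim: w => //= c w IH; exact: F_K. Qed.

Lemma K_word m x : K x -> exists w y, [/\ size w = m, K y & Fw q w y = x].
Proof.
elim: m x => [|m IH] x Kx; first by exists [::], x.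
have [c [y [Ky <-]]] := K_cell Kx.
by have [w [z [wm Kz <-]]] := IH y Ky; exists (c :: w), z; rewrite /= wm.
Qed.

Lemma K_bounded : exists M : R, 0 <= M /\ forall x, K x -> `|x| <= M.
Proof.
have [M [_ HM]] := compact_bounded K_compact.
exists (`|M| + 1); split; first by rewrite addr_ge0.
by move=> x Kx; apply: HM => //; rewrite (le_lt_trans (ler_norm M)) // ltrDl.
Qed.

(** If s is the supremum of [- bary k] on the gasket, self-similarity and [bary_F] give s <= s / 4,
    hence s <= 0. *)
Lemma bary_ge0 k x : K x -> 0 <= bary k x.
Proof.
pose S := [set - bary k y | y in K].
have [M [M_ge0 HM]] := K_bounded.
(* A crude bound, from boundedness of the gasket, that makes this supremum finite. *)
pose C : R := (`|(q (k + 1)).1| + M) * (`|(q (k - 1)).2| + M)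
   + (`|(q (k + 1)).2| + M) * (`|(q (k - 1)).1| + M).
have supS : has_sup S.
  split; first by have [y Ky] := K_neq0; exists (- bary k y), y.
  exists (C / `|det|) => _ [y Ky <-].
  have [y1 y2] : `|y.1| <= M /\ `|y.2| <= M.
    have := HM y Ky; rewrite prod_normE /= ge_max => /andP[]; by split.
  apply: le_trans (ler_norm _) _; rewrite normrN /bary normrM normfV.
  rewrite ler_pM2r ?invr_gt0 ?normr_gt0 //.
  apply: (le_trans (ler_normB _ _)); rewrite !normrM.
  by apply: lerD; apply: ler_pM => //; apply: (le_trans (ler_normB _ _));
    rewrite lerD2l.
have sup_le : sup S <= sup S / 4.
  apply: ge_sup => [|_ [y Ky <-]]; first by case: supS.
  have [c [t [Kt <-]]] := K_cell Ky; rewrite bary_F.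
  have : - bary k t <= sup S by apply: sup_ubound; [case: supS|exists t].
  have : 0 <= (k == c.2)%:R :> R by rewrite ler0n.
  have : 0 <= (k == c.1)%:R :> R by rewrite ler0n.
  by lra.
move=> Kx; have : - bary k x <= sup S by apply: sup_ubound; [case: supS|exists x].
by lra.
Qed.

Lemma bary_le1 k x : K x -> bary k x <= 1.
Proof.
move=> Kx; rewrite -(bary_sum x) (bigD1 k) //= lerDl.
by apply: sumr_ge0 => l _; exact: bary_ge0.
Qed.

Lemma bary_eq1 k x : K x -> bary k x = 1 -> x = q k.
Proof.
move=> Kx x1; apply: bary_inj => l; rewrite bary_q.
have := bary_sum x; rewrite sum3.
have := bary_ge0 0 Kx; have := bary_ge0 1 Kx; have := bary_ge0 2 Kx.
by move: x1; elim/I3_ind: k => x1; elim/I3_ind: l; rewrite ?eqxx ?I3E /=; lra.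
Qed.

(** Four times a barycentric coordinate of a point of a cell is that of its preimage, which lies in
    [0, 1], plus an integer fixed by the cell. Two distinct cells can thus meet only where a
    coordinate of each preimage equals 1, that is at corners. *)
Lemma cell_meet c c' x y : K x -> K y -> Fc c x = Fc c' y ->
  (c = c' /\ x = y) \/
  exists k k', [/\ x = q k, y = q k' & mate (c, k) = (c', k')].
Proof.
case: c => i j; case: c' => i' j' /= Kx Ky xy.
have E k : bary k x + (k == j)%:R + 2 * (k == i)%:R
    = bary k y + (k == j')%:R + 2 * (k == i')%:R.
  by have := congr1 (bary k) xy; rewrite !bary_F; lra.
have bool01 (b : bool) : 0 <= b%:R :> R /\ b%:R <= 1 :> R by case: b; rewrite ?lexx ?ler01.
have [ii|ii] := eqVneq i i'.
  move: E; rewrite -ii => E; have [jj|jj] := eqVneq j j'.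
    left; split; first by rewrite jj.
    by apply: bary_inj => k; have := E k; rewrite jj; lra.
  right; exists j', j; split.
  - apply: bary_eq1 => //; have := E j'; rewrite eqxx eq_sym (negbTE jj) /=.
    by have := bary_ge0 j' Ky; have := bary_le1 j' Kx; lra.
  - apply: bary_eq1 => //; have := E j; rewrite eqxx (negbTE jj) /=.
    by have := bary_ge0 j Kx; have := bary_le1 j Ky; lra.
  - by rewrite /= (negbTE jj).
have ii' : (i' == i) = false by rewrite eq_sym (negbTE ii).
(* Coordinate [i] leaves no slack: the left side is at least 2 and the right side at most 2, which
   forces [j' = i] and [bary i y = 1]; coordinate [i'] is symmetric. *)
have Ei := E i; have Ei' := E i'; move: Ei Ei'.
rewrite !eqxx (negbTE ii) ii' /= => Ei Ei'.
have x0 := bary_ge0 i Kx; have x1 := bary_le1 i' Kx.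
have y0 := bary_ge0 i' Ky; have y1 := bary_le1 i Ky.
have ij' : j' = i.
  move: Ei; have [|_] := eqVneq i j'; first by move=> ->.
  by have [b0 b1] := bool01 (i == j); move=> H; exfalso; move: H => /=; lra.
have i'j : j = i'.
  move: Ei'; have [|_] := eqVneq i' j; first by move=> ->.
  by have [b0 b1] := bool01 (i' == j'); move=> H; exfalso; move: H => /=; lra.
move: Ei Ei'; rewrite ij' i'j !eqxx (negbTE ii) ?ii' /= => Ei Ei'.
right; exists i', i; split.
- by apply: bary_eq1 => //; lra.
- by apply: bary_eq1 => //; lra.
- by rewrite eqxx.
Qed.

Lemma exp4_small (e : R) : 0 < e -> exists m, forall n, (m <= n)%N -> (4 ^+ n)^-1 < e.
Proof.
move=> e_gt0; have small : `|4^-1 : R| < 1 by rewrite gtr0_norm; lra.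
have := cvg_expr small => /cvgrPdist_lt /(_ e e_gt0) [m _ Hm].
exists m => n mn; have := Hm n mn; by rewrite sub0r normrN exprVn gtr0_norm.
Qed.

Lemma q_K k : K (q k).
Proof.
have [y Ky] := K_neq0; apply: K_closed => B /nbhs_ballP[e /= e_gt0 eB].
have d_gt0 : 0 < e / (`|q k - y| + 1).
  by rewrite divr_gt0 // ltr_wpDl.
have [m /(_ m (leqnn m)) Hm] := exp4_small d_gt0.
exists (Fw q (nseq m (k, k)) y); split; first exact: Fw_K.
apply: eB; rewrite -ball_normE /=.
have -> : q k = Fw q (nseq m (k, k)) (q k).
  by elim: m {Hm} => //= m <-; rewrite F_q.
rewrite Fw_dist size_nseq; move: Hm; rewrite ltr_pdivlMr ?ltr_wpDl // mulrC.
by apply: le_lt_trans; rewrite ler_wpM2r ?lerDl // invr_ge0 exprn_ge0.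
Qed.

(** Uniform continuity read cell by cell, equivalent to continuity on the gasket by the next two
    lemmas; it suits functions defined by gluing. *)
Definition cell_uniform (u : plane R -> R) := forall e : R, 0 < e ->
  exists m, forall w, (m <= size w)%N -> forall x y, K x -> K y ->
    `|u (Fw q w x) - u (Fw q w y)| <= e.

Lemma cell_uniform_continuous (u : plane R -> R) : cell_uniform u -> {within K, continuous u}.
Proof.
move=> u_unif; apply/subspace_continuousP => x Kx; apply/cvgrPdist_le => e e_gt0.
have [m Hm] := u_unif e e_gt0.
(* Off these finitely many closed cells, every gasket point shares an [m]-cell with [x]. *)
pose far := \bigcup_(w in [set w : m.-tuple cell | ~ (Fw q w @` K) x]) (Fw q w @` K).
have far_closed : closed far.
  apply: closed_bigcup; first exact: finite_finset.
  move=> w _; apply: compact_closed; first exact: norm_hausdorff.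
  apply: continuous_compact; last exact: K_compact.
  by apply: continuous_subspaceT; exact: Fw_continuous.
have : nbhs x (~` far).
  apply: open_nbhs_nbhs; split; first by apply: closed_openC.
  by move=> [w /= nwx wx].
move=> Hfar; rewrite near_withinE; near=> y => Ky.
have [w [z [wm Kz zy]]] := K_word m Ky.
have far_y : ~ far y by near: y.
have [t Kt tx] : (Fw q w @` K) x.
  apply: contrapT => nwx; apply: far_y; exists (tcast wm (in_tuple w)).
    by rewrite /= val_tcast.
  by rewrite /= val_tcast; exists z.
by rewrite -zy -tx; apply: Hm => //; rewrite wm.
Unshelve. all: by end_near.
Qed.

Lemma continuous_cell_uniform (u : plane R -> R) : {within K, continuous u} -> cell_uniform u.
Proof.
move=> /subspace_continuousP u_cont e e_gt0; apply: contrapT => Hno.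
have Hm m : exists t : seq cell * (plane R * plane R),
    [/\ (m <= size t.1)%N, K t.2.1, K t.2.2
      & e < `|u (Fw q t.1 t.2.1) - u (Fw q t.1 t.2.2)|].
  apply: contrapT => H; apply: Hno; exists m => w mw x y Kx Ky.
  by rewrite leNgt; apply/negP => lt; apply: H; exists (w, (x, y)).
have [s Hs] := choice Hm.
(* The offending pairs lie in cells whose diameters tend to 0, so at a cluster point of [z] the
   values at [z m] and [z' m] both come close to that of [u]. *)
pose z m := Fw q (s m).1 (s m).2.1; pose z' m := Fw q (s m).1 (s m).2.2.
have Kz m : K (z m) by have [_ ? _ _] := Hs m; exact: Fw_K.
have Kz' m : K (z' m) by have [_ _ ? _] := Hs m; exact: Fw_K.
have [|p [Kp clp]] := K_compact (F := z @ \oo); first by exists 0%N => // m _; exact: Kz.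
have /cvgrPdist_lt /(_ (e / 2)) := u_cont p Kp.
rewrite divr_gt0 // => /(_ isT); rewrite near_withinE => /nbhs_ballP[d /= d_gt0 dP].
have [M [M_ge0 HM]] := K_bounded.
have d'_gt0 : 0 < d / 2 / (2 * M + 1) by rewrite !divr_gt0 //; lra.
have [n Hn] := exp4_small d'_gt0.
have [||_ [[m nm <-] zp]] := clp (z @` [set m | (n <= m)%N]) (ball p (d / 2)).
- by exists n => // m nm; exists m.
- by apply: nbhsx_ballx; rewrite divr_gt0.
have [sm Ks Ks' lt_e] := Hs m.
have zz' : `|z m - z' m| < d / 2.
  rewrite /z /z' Fw_dist.
  have := Hn (size (s m).1) (leq_trans nm sm).
  rewrite ltr_pdivlMr; last lra.
  rewrite mulrC; apply: le_lt_trans; rewrite ler_wpM2r ?invr_ge0 ?exprn_ge0 //.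
  by have := ler_normB (s m).2.1 (s m).2.2; have := HM _ Ks; have := HM _ Ks'; lra.
move: zp; rewrite -ball_normE /= => zp.
have u1 := dP (z m) _ (Kz m); have u2 := dP (z' m) _ (Kz' m).
have : `|u p - u (z m)| < e / 2.
  by apply: u1; rewrite -ball_normE /=; lra.
have : `|u p - u (z' m)| < e / 2.
  apply: u2; rewrite -ball_normE /=.
  by have := ler_distD (z m) p (z' m); lra.
have := ler_distD (u p) (u (z m)) (u (z' m)); rewrite [`|_ - u p|]distrC.
by move: lt_e; rewrite -/(z m) -/(z' m); lra.
Qed.

Lemma continuous_K_bounded (u : plane R -> R) : {within K, continuous u} ->
  exists M : R, 0 <= M /\ forall x, K x -> `|u x| <= M.
Proof.
move=> u_cont; have cK : compact (u @` K).
  exact: continuous_compact u_cont K_compact.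
have [M [_ HM]] := compact_bounded cK.
exists (`|M| + 1); split; first by rewrite addr_ge0.
move=> x Kx; apply: HM; last by exists x.
by rewrite (le_lt_trans (ler_norm M)) // ltrDl.
Qed.

End Geometry.

(** * Harmonic functions and bumps on the gasket *)

Section Harmonic.
Context {R : realType} (q : 'I_3 -> plane R) (K : set (plane R)) (r : R).
Hypotheses (q_triangle : is_triangle q) (K_gasket : is_gasket q K) (r_gt0 : 0 < r).
Implicit Types (x y : plane R) (k l : 'I_3) (c : cell) (w : seq cell).
Implicit Types (b : 'I_3 -> R) (lo hi : R).

Notation Fc c := (F q c.1 c.2).

(* A chosen cell containing x, and the preimage of x in that cell. *)
Definition address x : cell * plane R :=
  xget ((0, 0), x) [set cy : cell * plane R | K cy.2 /\ Fc cy.1 cy.2 = x].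

Lemma addressP x : K x -> K (address x).2 /\ Fc (address x).1 (address x).2 = x.
Proof.
move=> Kx; rewrite /address; case: xgetP => [y _ //|H].
by have [c [y [Ky yx]]] := K_cell K_gasket Kx; case: (H (c, y)).
Qed.

Definition glue (u : cell -> plane R -> R) x : R := u (address x).1 (address x).2.

(** The choice made by [address] matters only at junctions ([cell_meet]), where the hypothesis makes
    both values agree. *)
Lemma glue_F u c x :
  (forall y : corner, u (mate y).1 (q (mate y).2) = u y.1 (q y.2)) ->
  K x -> glue u (Fc c x) = u c x.
Proof.
move=> u_mate Kx; have [Ky yx] := addressP (F_K K_gasket c Kx).
rewrite /glue; set c' := (address _).1 in yx *; set y := (address _).2 in Ky yx *.
have [[-> -> //]|[k [k' [-> ->]]]] := cell_meet q_triangle K_gasket Ky Kx yx.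
by move=> kk'; have := u_mate (c', k); rewrite kk'.
Qed.

Lemma glue_unif u :
  (forall y : corner, u (mate y).1 (q (mate y).2) = u y.1 (q y.2)) ->
  (forall c, cell_uniform q K (u c)) -> cell_uniform q K (glue u).
Proof.
move=> u_mate u_unif e e_gt0.
have [m Hm] := choice (fun c => u_unif c e e_gt0).
exists (\max_c m c).+1 => -[|c w] //= mw x y Kx Ky.
rewrite !glue_F //; try exact: Fw_K.
by apply: Hm => //; apply: leq_trans (leq_bigmax c) _; exact: mw.
Qed.

Definition vmin b : R := Num.min (b 0) (Num.min (b 1) (b 2)).

Lemma vmin_le b k : vmin b <= b k.
Proof.
by elim/I3_ind: k; rewrite /vmin !ge_min lexx ?orbT.
Qed.

Lemma le_vmin lo b : (forall k, lo <= b k) -> lo <= vmin b.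
Proof. by move=> lo_le; rewrite /vmin !le_min !lo_le. Qed.

(** A lower bound read off the chosen cell of level [m] around [x]. It increases with [m], because
    harmonic extension never goes below the minimum, so its limit exists at once; that the chosen
    addresses do not matter is shown in [harm_F]. *)
Fixpoint harm_approx (m : nat) b x : R :=
  if m is m'.+1 then harm_approx m' (hext r (address x).1 b) (address x).2
  else vmin b.

Definition harm b x : R := limn (fun m => harm_approx m b x).

Lemma harm_approx_homo b x :
  {homo (fun m => harm_approx m b x) : m n / (m <= n)%N >-> m <= n}.
Proof.
apply/nondecreasing_seqP => m; elim: m b x => [|m IH] b x /=; last exact: IH.
apply: le_vmin => k; rewrite -(hext_cst (address x).1 (vmin b) k r_gt0).
by apply: ler_sum => l _; rewrite ler_wpM2l ?hv_ge0 // vmin_le.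
Qed.

Lemma harm_approx_bounds lo hi m b x : within_bounds lo hi b ->
  lo <= harm_approx m b x <= hi.
Proof.
elim: m b x => [|m IH] b x b_in /=; last by apply/IH/hext_bounds.
apply/andP; split; first by apply: le_vmin => k; case/andP: (b_in k).
by apply: le_trans (vmin_le b 0) _; case/andP: (b_in 0).
Qed.

Lemma has_bounds b : exists lo hi, lo <= hi /\ within_bounds lo hi b.
Proof.
exists (vmin b), (Num.max (b 0) (Num.max (b 1) (b 2))).
have H : within_bounds (vmin b) (Num.max (b 0) (Num.max (b 1) (b 2))) b.
  move=> k; rewrite vmin_le /=.
  by elim/I3_ind: k; rewrite !le_max lexx ?orbT.
by split=> //; case/andP: (H 0); exact: le_trans.
Qed.

Lemma harm_approx_cvg b x : cvgn (fun m => harm_approx m b x).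
Proof.
apply: nondecreasing_is_cvgn; first exact: harm_approx_homo.
have [lo [hi [_ b_in]]] := has_bounds b.
by exists hi => _ [m _ <-]; case/andP: (harm_approx_bounds m x b_in).
Qed.

Lemma harm_bounds lo hi b x : within_bounds lo hi b -> lo <= harm b x <= hi.
Proof.
move=> b_in; apply/andP; split.
  apply: limr_ge; first exact: harm_approx_cvg.
  by apply: nearW => m; case/andP: (harm_approx_bounds m x b_in).
apply: limr_le; first exact: harm_approx_cvg.
by apply: nearW => m; case/andP: (harm_approx_bounds m x b_in).
Qed.

Lemma harm_address b x : harm b x = harm (hext r (address x).1 b) (address x).2.
Proof.
apply/cvg_lim => //; rewrite -(cvg_shiftS (fun m => harm_approx m b x)) /=.
exact: harm_approx_cvg.
Qed.

Lemma q_inj : injective q.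
Proof.
move=> k l kl; apply/eqP; have := bary_q q_triangle k k.
by rewrite kl bary_q // eqxx; case: eqP => // _ /eqP; rewrite eq_sym oner_eq0.
Qed.

Lemma address_q k : address (q k) = ((k, k), q k).
Proof.
have Kq := q_K K_gasket k; have [Ky yx] := addressP Kq.
move: Ky yx; case: (address _) => c y /= Ky yx.
have {}yx : Fc c y = Fc (k, k) (q k) by rewrite F_q.
have [[-> -> //]|[k1 [k2 [-> /q_inj <-]]]] := cell_meet q_triangle K_gasket Ky Kq yx.
move=> /(congr1 mate); rewrite mateK mate_bdry /= ?eqxx // => -[-> ->].
by [].
Qed.

(* The approximation gap shrinks by the contraction factor at every level. *)
Lemma harm_q b k : harm b (q k) = b k.
Proof.
have [lo [hi [lo_hi b_in]]] := has_bounds b.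
have H m : `|harm b (q k) - b k| <= theta r ^+ m * (hi - lo).
  elim: m b lo hi lo_hi b_in => [|m IH] b lo hi lo_hi b_in.
    have /andP[h1 h2] := harm_bounds (q k) b_in.
    have /andP[b1 b2] := b_in k.
    by rewrite expr0 mul1r ler_norml; apply/andP; split; lra.
  rewrite harm_address address_q /=.
  have [lo' [hi' [b'_in _ _ wE]]] := hext_contract (k, k) r_gt0 b_in.
  rewrite -(hext_diag b k r_gt0) exprSr -mulrA -wE; apply: IH => //.
  by rewrite -subr_ge0 wE mulr_ge0 ?theta_ge0 // subr_ge0.
apply/eqP; rewrite -subr_eq0 -normr_eq0 eq_le normr_ge0 andbT.
have small : (fun m => (hi - lo) * theta r ^+ m) @ \oo --> (0 : R).
  apply: cvg_geometric; rewrite ger0_norm ?theta_ge0 //; exact: theta_lt1.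
have <- : limn (fun m => (hi - lo) * theta r ^+ m) = 0 by exact/cvg_lim.
apply: limr_ge; first by apply/cvg_ex; exists 0.
by apply: nearW => m; rewrite mulrC.
Qed.

Lemma harm_F c b x : K x -> harm b (Fc c x) = harm (hext r c b) x.
Proof.
move=> Kx; rewrite harm_address.
apply: (glue_F (u := fun c => harm (hext r c b))) => // y.
by rewrite !harm_q hext_mate.
Qed.

Definition hextw w b := foldl (fun b c => hext r c b) b w.

Lemma harm_Fw w b x : K x -> harm b (Fw q w x) = harm (hextw w b) x.
Proof.
move=> Kx; elim: w b => //= c w IH b; rewrite harm_F ?IH //; exact: Fw_K.
Qed.

Lemma hextw_contract w b lo hi : within_bounds lo hi b ->
  exists lo' hi', [/\ within_bounds lo' hi' (hextw w b), lo <= lo', hi' <= hi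
    & hi' - lo' = theta r ^+ size w * (hi - lo)].
Proof.
elim: w b lo hi => [|c w IH] b lo hi b_in /=.
  by exists lo, hi; rewrite mul1r.
have [lo1 [hi1 [b1_in lo1_ge hi1_le E1]]] := hext_contract c r_gt0 b_in.
have [lo2 [hi2 [b2_in lo2_ge hi2_le E2]]] := IH _ _ _ b1_in.
exists lo2, hi2; split => //; [exact: le_trans lo2_ge|exact: le_trans hi1_le|].
by rewrite E2 E1 exprSr mulrA.
Qed.

Lemma theta_small (e C : R) : 0 < e -> exists m, forall n, (m <= n)%N ->
  theta r ^+ n * C <= e.
Proof.
move=> e_gt0; have small : (fun m => C * theta r ^+ m) @ \oo --> (0 : R).
  apply: cvg_geometric; rewrite ger0_norm ?theta_ge0 //; exact: theta_lt1.
have := small => /cvgrPdist_le /(_ e e_gt0) [m _ Hm].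
exists m => n mn; have := Hm n mn; rewrite sub0r normrN mulrC.
exact: le_trans (ler_norm _).
Qed.

Lemma harm_unif b : cell_uniform q K (harm b).
Proof.
move=> e e_gt0; have [lo [hi [_ b_in]]] := has_bounds b.
have [m Hm] := theta_small (hi - lo) e_gt0.
exists m => w mw x y Kx Ky; rewrite !harm_Fw //.
have [lo' [hi' [b'_in _ _ E]]] := hextw_contract w b_in.
have := Hm _ mw; rewrite -E => le_e.
have /andP[x1 x2] := harm_bounds x b'_in; have /andP[y1 y2] := harm_bounds y b'_in.
by apply: le_trans le_e; rewrite ler_norml; apply/andP; split; lra.
Qed.

(* The function with values [B c k] at the corners of V_1 of the cell F_w SG,
   harmonic inside the cells of the next level and zero outside F_w SG. *)
Fixpoint bump (B : cell -> 'I_3 -> R) w : plane R -> R :=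
  if w is c :: w' then glue (fun c' x => if c' == c then bump B w' x else 0)
  else glue (fun c => harm (B c)).

Section Bump.
Variable B : cell -> 'I_3 -> R.
Hypothesis B_mate : forall x : corner, B (mate x).1 (mate x).2 = B x.1 x.2.
Hypothesis B_bdry : forall k, B (k, k) k = 0.

Let glue_base (y : corner) : harm (B (mate y).1) (q (mate y).2) = harm (B y.1) (q y.2).
Proof. by rewrite !harm_q. Qed.

(** Vanishing on V_0 is what makes the extension by zero outside a cell agree at its corners;
    [bump_cons] depends on it. *)
Lemma bump_q w k : bump B w (q k) = 0.
Proof.
have qE k' : q k' = Fc (k', k') (q k') by rewrite F_q.
elim: w k => [|c w IH] k.
  transitivity (harm (B (k, k)) (q k)); last by rewrite harm_q.
  rewrite {1}qE; exact: (glue_F (u := fun c => harm (B c)) (k, k) glue_base (q_K K_gasket k)).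
transitivity (if (k, k) == c then bump B w (q k) else 0); last by rewrite IH if_same.
have w_mate (y : corner) : (if (mate y).1 == c then bump B w (q (mate y).2) else 0)
    = (if y.1 == c then bump B w (q y.2) else 0) by rewrite !IH !if_same.
rewrite {1}qE; exact: (glue_F (u := fun c' x => if c' == c then bump B w x else 0)
  (k, k) w_mate (q_K K_gasket k)).
Qed.

Let glue_step c w (y : corner) :
  (if (mate y).1 == c then bump B w (q (mate y).2) else 0)
  = (if y.1 == c then bump B w (q y.2) else 0).
Proof. by rewrite !bump_q !if_same. Qed.

Lemma bump_nil c x : K x -> bump B [::] (Fc c x) = harm (B c) x.
Proof. exact: (glue_F (u := fun c => harm (B c)) c glue_base). Qed.

Lemma bump_cons c c' w x : K x ->
  bump B (c :: w) (Fc c' x) = if c' == c then bump B w x else 0.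
Proof.
exact: (glue_F (u := fun c' x => if c' == c then bump B w x else 0)
  c' (glue_step c w)).
Qed.

Lemma bump_unif w : cell_uniform q K (bump B w).
Proof.
elim: w => [|c w IH] /=; first by apply: glue_unif => // c; exact: harm_unif.
apply: glue_unif => [y|c']; first exact: glue_step.
case: eqP => // _ e e_gt0; exists 0%N => v _ x y _ _.
by rewrite subrr normr0 ltW.
Qed.

End Bump.

End Harmonic.

(** * Integration *)

Section Integral.
Context {R : realType} (q : 'I_3 -> plane R) (K : set (plane R)) (r : R).
Context (mu : probability (borel_plane R) R).
Hypotheses (q_triangle : is_triangle q) (K_gasket : is_gasket q K) (r_gt0 : 0 < r).
Hypothesis mu_ss : is_self_similar_measure q K r mu.
Implicit Types (x y : plane R) (k l : 'I_3) (c : cell) (w : seq cell).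
Implicit Types (g : plane R -> R).

Notation Fc c := (F q c.1 c.2).

Lemma closed_borel (A : set (plane R)) : closed A -> measurable (A : set (borel_plane R)).
Proof.
move=> cA; rewrite -[A]setCK; apply: measurableC.
by apply: sub_gen_smallest; exact: closed_openC.
Qed.

Lemma K_borel : measurable (K : set (borel_plane R)).
Proof. by apply: closed_borel; exact: K_closed K_gasket. Qed.

Lemma FwK_borel w : measurable (Fw q w @` K : set (borel_plane R)).
Proof.
apply: closed_borel; apply: compact_closed; first exact: norm_hausdorff.
apply: continuous_compact (K_compact K_gasket).
by apply: continuous_subspaceT; exact: Fw_continuous.
Qed.

Lemma FwK_sub w : Fw q w @` K `<=` K.
Proof. by move=> _ [x Kx <-]; exact: Fw_K. Qed.

Definition mword w : R := \prod_(c <- w) msr r c.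

Lemma mu_FwK w : mu (Fw q w @` K) = (mword w)%:E.
Proof.
have [muK mu_F] := mu_ss; elim: w => [|c w IH].
  by rewrite /mword big_nil -muK; congr (mu _); rewrite /= image_id.
rewrite /mword big_cons EFinM -/(mword w) -IH /=.
rewrite [X in mu X](_ : _ = Fc c @` (Fw q w @` K)); last by rewrite -image_comp.
rewrite mu_F; [|exact: FwK_borel|exact: FwK_sub].
by rewrite /msr; case: c.
Qed.

Lemma continuous_measurable g : {within K, continuous g} ->
  measurable_fun (K : set (borel_plane R)) g.
Proof.
move=> /continuousP cg; apply: (measurability _ (RGenOpens.measurableE R)).
move=> _ [_ [a [b ->] <-]].
have oab : open `]a, b[%classic by exact: interval_open.
have /open_subspaceP[V oV VE] := cg _ oab.
have -> : K `&` g @^-1` `]a, b[ = K `&` V by rewrite setIC -VE setIC.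
apply: measurableI; first exact: K_borel.
exact: sub_gen_smallest.
Qed.

Lemma K_finite : (mu K < +oo)%E.
Proof. by rewrite (le_lt_trans (probability_le1 mu K_borel)) // ltry. Qed.

Lemma fine_mu_K : fine (mu K) = 1.
Proof. by case: mu_ss => muK _; exact: (congr1 fine muK). Qed.

Lemma continuous_integrable g : {within K, continuous g} ->
  mu.-integrable K (EFin \o g).
Proof.
move=> cg; apply: measurable_bounded_integrable.
- exact: K_borel.
- exact: K_finite.
- exact: continuous_measurable.
- have [M [_ HM]] := continuous_K_bounded K_gasket cg.
  by exists M; split; rewrite ?num_real // => z Mz x Kx; apply: le_trans (HM x Kx) (ltW Mz).
Qed.

Lemma cst_integrable (z : R) : mu.-integrable K (EFin \o (fun=> z)).
Proof. by apply: continuous_integrable; apply: cst_continuous. Qed.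

Lemma indic_integral w :
  mu.-integrable K (EFin \o \1_(Fw q w @` K)) /\
  \int[mu]_(x in K) \1_(Fw q w @` K) x = mword w.
Proof.
split.
  apply: measurable_bounded_integrable.
  - exact: K_borel.
  - exact: K_finite.
  - by apply: measurable_indic; exact: FwK_borel.
  - exists 1; split; rewrite ?num_real // => z z_gt1 x _.
    by rewrite /= indicE ger0_norm ?ler0n // (le_trans _ (ltW z_gt1)) // lern1 leq_b1.
rewrite /Rintegral integral_indic; [|exact: K_borel|exact: FwK_borel].
rewrite setIidl; last exact: FwK_sub.
exact: (congr1 fine (mu_FwK w)).
Qed.

Lemma step_integral (s : seq (seq cell)) (a : seq cell -> R) :
  mu.-integrable K (EFin \o (fun x => \sum_(w <- s) a w * \1_(Fw q w @` K) x)) /\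
  \int[mu]_(x in K) (\sum_(w <- s) a w * \1_(Fw q w @` K) x)
  = \sum_(w <- s) a w * mword w.
Proof.
elim: s => [|w s [IH1 IH2]].
  rewrite (_ : (fun x => _) = fun=> 0); last by apply/funext => x; rewrite big_nil.
  split; first exact: cst_integrable.
  by rewrite Rintegral_cst ?mul0r ?big_nil //; exact: K_borel.
have [Iw Ew] := indic_integral w; have mK := K_borel.
have Iaw : mu.-integrable K (EFin \o (fun x => a w * \1_(Fw q w @` K) x)).
  have := integrableZl mK (a w) Iw.
  by congr (integrable _ _ _); apply/funext => x; rewrite /= EFinM.
rewrite (_ : (fun x => _) = fun x => a w * \1_(Fw q w @` K) x
  + \sum_(w <- s) a w * \1_(Fw q w @` K) x); last first.
  by apply/funext => x; rewrite big_cons.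
split.
  have := integrableD mK Iaw IH1.
  by congr (integrable _ _ _); apply/funext => x; rewrite /= EFinD.
by rewrite RintegralD // IH2 RintegralZl // Ew big_cons.
Qed.

Lemma sum_tuple_cons (V : nmodType) m (G : seq cell -> V) :
  \sum_(w : m.+1.-tuple cell) G w = \sum_c \sum_(w : m.-tuple cell) G (c :: w).
Proof.
rewrite pair_bigA /= (reindex (fun p : cell * m.-tuple cell => [tuple of p.1 :: p.2])) //.
exists (fun t => (thead t, [tuple of behead t])) => [[c w] _ | t _] /=.
  by congr pair; apply: val_inj.
by rewrite -tuple_eta.
Qed.

Lemma sum_mword m : \sum_(w : m.-tuple cell) mword w = 1.
Proof.
elim: m => [|m IH].
  rewrite (big_pred1 [tuple]) => [|w]; first by rewrite /mword big_nil.
  by apply/esym/eqP; apply: val_inj; case: w => -[].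
rewrite sum_tuple_cons -(sum_msr r_gt0); apply: eq_bigr => c _.
rewrite -[RHS]mulr1 -IH mulr_sumr; apply: eq_bigr => w _.
by rewrite /mword big_cons.
Qed.

(** Cells overlap at junctions, where the step function adds several coefficients. Adding [M] makes
    all coefficients nonnegative, so overlaps can only raise it and the upper bound survives. *)
Lemma integral_upper m g (a : seq cell -> R) : {within K, continuous g} ->
  (forall (w : m.-tuple cell) y, K y -> g (Fw q w y) <= a w) ->
  \int[mu]_(x in K) g x <= \sum_(w : m.-tuple cell) mword w * a w.
Proof.
move=> cg g_le; have mK := K_borel.
have [M [M_ge0 HM]] := continuous_K_bounded K_gasket cg.
pose s := map (@tval m cell) (index_enum {: m.-tuple cell}).
have sumE (h : seq cell -> R) : \sum_(w <- s) h w = \sum_(w : m.-tuple cell) h w.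
  by rewrite big_map.
have aM_ge0 (w : m.-tuple cell) : 0 <= a w + M.
  have [y Ky] := K_neq0 K_gasket; have := g_le w y Ky.
  have := HM _ (Fw_K K_gasket w Ky); rewrite ler_norml => /andP[]; lra.
have [I1 E1] := step_integral s (fun w => a w + M).
have le_step : \int[mu]_(x in K) (g x + M)
    <= \int[mu]_(x in K) (\sum_(w <- s) (a w + M) * \1_(Fw q w @` K) x).
  apply: le_Rintegral => //.
    have := integrableD mK (continuous_integrable cg) (cst_integrable M).
    by congr (integrable _ _ _); apply/funext => x; rewrite /= EFinD.
  move=> x Kx; have [w [y [wm Ky wy]]] := K_word K_gasket m Kx.
  have wm' : size w == m by apply/eqP.
  rewrite sumE (bigD1 (Tuple wm')) //= indicE (_ : x \in _ = true); last first.
    by apply/mem_set; exists y.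
  rewrite mulr1 -wy -[X in X <= _]addr0 lerD //.
    by rewrite lerD2r; exact: (g_le (Tuple wm')).
  by apply: sumr_ge0 => v _; rewrite mulr_ge0 // indicE ler0n.
have gM : \int[mu]_(x in K) (g x + M) = \int[mu]_(x in K) g x + M.
  rewrite RintegralD //; [|exact: continuous_integrable|exact: cst_integrable].
  by rewrite Rintegral_cst // fine_mu_K mulr1.
move: le_step; rewrite gM E1 sumE.
have -> : \sum_(w : m.-tuple cell) (a w + M) * mword w
    = \sum_(w : m.-tuple cell) mword w * a w + M.
  rewrite -[X in _ + X]mulr1 -(sum_mword m) mulr_sumr -big_split /=.
  by apply: eq_bigr => w _; ring.
by rewrite lerD2r.
Qed.

Lemma integral_approx m g (a : seq cell -> R) (e : R) : {within K, continuous g} ->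
  (forall (w : m.-tuple cell) y, K y -> `|g (Fw q w y) - a w| <= e) ->
  `|\int[mu]_(x in K) g x - \sum_(w : m.-tuple cell) mword w * a w| <= e.
Proof.
move=> cg g_near.
have sumD (z : R) (b : seq cell -> R) : \sum_(w : m.-tuple cell) mword w * (b w + z)
    = \sum_(w : m.-tuple cell) mword w * b w + z.
  rewrite -[X in _ + X]mulr1 -(sum_mword m) mulr_sumr -big_split /=.
  by apply: eq_bigr => w _; ring.
have up := @integral_upper m g (fun w => a w + e) cg.
have cgN : {within K, continuous (fun x => -1 * g x)}.
  by move=> x; apply: cvgM; [exact: cvg_cst|exact: cg].
have down := @integral_upper m (fun x => -1 * g x) (fun w => - a w + e) cgN.
have IN : \int[mu]_(x in K) (-1 * g x) = - \int[mu]_(x in K) g x.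
  rewrite RintegralZl ?mulN1r //; first exact: K_borel.
  exact: continuous_integrable.
move: up down; rewrite IN (sumD e a) (sumD e (fun w => - a w)) => up down.
have aN : \sum_(w : m.-tuple cell) mword w * - a w
    = - \sum_(w : m.-tuple cell) mword w * a w.
  by rewrite -sumrN; apply: eq_bigr => w _; rewrite mulrN.
rewrite aN in down.
have {}up : \int[mu]_(x in K) g x <= \sum_(w : m.-tuple cell) mword w * a w + e.
  by apply: up => w y Ky; have := g_near w y Ky; rewrite ler_norml => /andP[]; lra.
rewrite ler_norml; apply/andP; split; last by lra.
have /down : forall (w : m.-tuple cell) y, K y -> -1 * g (Fw q w y) <= - a w + e.
  by move=> w y Ky; have := g_near w y Ky; rewrite ler_norml => /andP[]; lra.
by lra.
Qed.

Lemma unif_Fw w g : cell_uniform q K g -> cell_uniform q K (g \o Fw q w).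
Proof.
move=> g_unif e /g_unif[m Hm]; exists m => v mv x y Kx Ky.
rewrite /= -!Fw_cat; apply: Hm => //.
by rewrite size_cat (leq_trans mv) // leq_addl.
Qed.

Lemma continuous_Fw w g : {within K, continuous g} -> {within K, continuous (g \o Fw q w)}.
Proof.
move/(continuous_cell_uniform K_gasket)/(unif_Fw w).
exact: cell_uniform_continuous.
Qed.

Lemma eq_small (y z : R) : (forall e : R, 0 < e -> `|y - z| <= e) -> y = z.
Proof.
move=> H; apply/eqP; rewrite -subr_eq0 -normr_eq0 eq_le normr_ge0 andbT.
by apply/ler_addgt0Pr => e /H; rewrite add0r.
Qed.

(** Both sides are within e / 2 of the same Riemann sum over the cells of level m + 1, which splits
    along the first letter. *)
Lemma integral_cells g : {within K, continuous g} ->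
  \int[mu]_(x in K) g x = \sum_c msr r c * \int[mu]_(x in K) g (Fc c x).
Proof.
move=> cg; have g_unif := continuous_cell_uniform K_gasket cg.
apply: eq_small => e e_gt0.
have e2_gt0 : 0 < e / 2 by rewrite divr_gt0.
have [m Hm] := g_unif _ e2_gt0.
pose a w := g (Fw q w (q 0)); have Kq := q_K K_gasket 0.
have H1 : `|\int[mu]_(x in K) g x - \sum_(w : m.+1.-tuple cell) mword w * a w| <= e / 2.
  apply: integral_approx => // w y Ky; apply: Hm => //.
  by rewrite size_tuple.
have H2 c : `|\int[mu]_(x in K) g (Fc c x)
    - \sum_(w : m.-tuple cell) mword w * a (c :: w)| <= e / 2.
  apply: (integral_approx (g := g \o Fw q [:: c]) (a := fun w => a (c :: w))).
    exact: continuous_Fw.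
  move=> w y Ky; apply: (Hm (c :: w)) => //.
  by rewrite /= size_tuple.
have H3 : `|\sum_c msr r c * \int[mu]_(x in K) g (Fc c x)
    - \sum_(w : m.+1.-tuple cell) mword w * a w| <= e / 2.
  rewrite (sum_tuple_cons m (fun w => mword w * a w)) -sumrB.
  apply: (le_trans (ler_norm_sum _ _ _)).
  apply: (@le_trans _ _ (\sum_c msr r c * (e / 2))); last first.
    by rewrite -mulr_suml sum_msr // mul1r.
  apply: ler_sum => c _.
  rewrite (_ : \sum_(w : m.-tuple cell) mword (c :: w) * a (c :: w)
    = msr r c * \sum_(w : m.-tuple cell) mword w * a (c :: w)); last first.
    rewrite mulr_sumr; apply: eq_bigr => w _.
    by rewrite /mword big_cons mulrA.
  have m_ge0 := ltW (msr_gt0 c r_gt0).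
  rewrite -mulrBr normrM (ger0_norm m_ge0); exact: ler_wpM2l.
move: H1 H3; set s := \sum_(w : m.+1.-tuple cell) _.
by rewrite !ler_norml => /andP[? ?] /andP[? ?]; apply/andP; split; lra.
Qed.

Definition sym g : seq cell -> 'I_3 -> R := fun w k => g (Fw q w (q k)).

Lemma sym_compat g : compat (sym g).
Proof.
split=> [w k|w x]; rewrite /sym -!cats1 !Fw_cat /=; first by rewrite F_q.
by congr (g (Fw q w _)); exact: F_mate.
Qed.

Lemma mom_sum m U b :
  mom r m U b = \sum_(w : m.-tuple cell) mword w * ((\sum_l hextw r w b l * U w l) / 3).
Proof.
elim: m U b => [|m IH] U b /=.
  rewrite (big_pred1 [tuple]) => [|w]; first by rewrite /mword big_nil mul1r.
  by apply/esym/eqP; apply: val_inj; case: w => -[].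
rewrite (sum_tuple_cons m (fun w => mword w * ((\sum_l hextw r w b l * U w l) / 3))).
apply: eq_bigr => c _; rewrite IH mulr_sumr; apply: eq_bigr => w _.
by rewrite /mword big_cons mulrA.
Qed.

Lemma continuousM_K g h : {within K, continuous g} -> {within K, continuous h} ->
  {within K, continuous (fun x => g x * h x)}.
Proof. by move=> cg ch x; apply: cvgM; [exact: cg|exact: ch]. Qed.

Lemma harm_continuous b : {within K, continuous (harm q K r b)}.
Proof. by apply: (cell_uniform_continuous K_gasket); exact: harm_unif. Qed.

(** In a cell of level m the harmonic factor varies by at most [theta r ^+ m * (hi - lo)] and g by
    little, so [mom] is a Riemann sum of the product. *)
Lemma mom_cvg g b : {within K, continuous g} ->
  (fun m => mom r m (sym g) b) @ \oo --> \int[mu]_(x in K) (harm q K r b x * g x).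
Proof.
move=> cg; apply/cvgrPdist_le => e e_gt0.
have [lo [hi [lo_hi b_in]]] := has_bounds b.
have [M [M_ge0 HM]] := continuous_K_bounded K_gasket cg.
pose N := `|lo| + `|hi| + 1.
have N_gt0 : 0 < N by rewrite ltr_wpDl ?addr_ge0.
have e2_gt0 : 0 < e / 2 / N by rewrite !divr_gt0.
have [m1 H1] := continuous_cell_uniform K_gasket cg e2_gt0.
have e2'_gt0 : 0 < e / 2 by rewrite divr_gt0.
have [m2 H2] := theta_small r_gt0 ((hi - lo) * M) e2'_gt0.
exists (maxn m1 m2) => // m; rewrite /= geq_max => /andP[mm1 mm2].
rewrite mom_sum; apply: (@integral_approx m _
  (fun w => (\sum_l hextw r w b l * sym g w l) / 3)).
  by apply: continuousM_K => //; exact: harm_continuous.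
move=> w y Ky; rewrite harm_Fw //.
have [lo' [hi' [b'_in lo_le hi_le E]]] := hextw_contract r_gt0 w b_in.
set b' := hextw r w b in b'_in *; set h := harm _ _ _ _ _.
have /andP[h1 h2] : lo' <= h <= hi' by exact: harm_bounds.
have each l : `|h * g (Fw q w y) - b' l * sym g w l| <= e.
  have -> : h * g (Fw q w y) - b' l * sym g w l
    = (h - b' l) * g (Fw q w y) + b' l * (g (Fw q w y) - sym g w l) by ring.
  have /andP[l1 l2] := b'_in l.
  have p1 : `|(h - b' l) * g (Fw q w y)| <= e / 2.
    apply: le_trans (H2 m mm2); rewrite normrM mulrA.
    rewrite size_tuple in E; rewrite -E.
    apply: ler_pM => //; last by apply: HM; exact: Fw_K.
    by rewrite ler_norml; apply/andP; split; lra.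
  have p2 : `|b' l * (g (Fw q w y) - sym g w l)| <= e / 2.
    rewrite normrM -[e / 2](divfK (lt0r_neq0 N_gt0)) mulrC.
    apply: ler_pM => //.
      by apply: H1 => //; [rewrite size_tuple|exact: (q_K K_gasket)].
    have := ler_norm hi; have := ler_norm (- lo); rewrite normrN.
    have := normr_ge0 lo; have := normr_ge0 hi; rewrite /N ler_norml => *.
    by apply/andP; split; lra.
  by apply: (le_trans (ler_normD _ _)); lra.
rewrite sum3; have := each 0; have := each 1; have := each 2.
by rewrite !ler_norml => /andP[? ?] /andP[? ?] /andP[? ?]; apply/andP; split; lra.
Qed.

Lemma sh_sym w g : sh w (sym g) = sym (g \o Fw q w).
Proof. by apply/funext => v; apply/funext => k; rewrite /sh /sym Fw_cat. Qed.

Lemma sym_reg g : {within K, continuous g} -> reg r (sym g).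
Proof.
move=> cg; split; first exact: sym_compat.
move=> w b; rewrite sh_sym; apply/cvg_ex.
by eexists; apply: mom_cvg; exact: continuous_Fw.
Qed.

Lemma sym_moment g b : {within K, continuous g} ->
  moment r (sym g) b = \int[mu]_(x in K) (harm q K r b x * g x).
Proof. by move=> cg; apply/cvg_lim => //; exact: mom_cvg. Qed.

Lemma sym_scu g : {within K, continuous g} -> scu (sym g).
Proof.
move/(continuous_cell_uniform K_gasket) => g_unif e /g_unif[m Hm].
exists m => w mw w' k k'; rewrite /sym Fw_cat; apply: Hm => //; last exact: (q_K K_gasket).
by apply: Fw_K => //; exact: (q_K K_gasket).
Qed.

End Integral.

(** * The weak Laplacian *)

Section Bridge.
Context {R : realType} (q : 'I_3 -> plane R) (K : set (plane R)) (r : R).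
Context (mu : probability (borel_plane R) R).
Hypotheses (q_triangle : is_triangle q) (K_gasket : is_gasket q K) (r_gt0 : 0 < r).
Hypothesis mu_ss : is_self_similar_measure q K r mu.
Implicit Types (x y : plane R) (k l : 'I_3) (c : cell) (w : seq cell).
Implicit Types (u v f g : plane R -> R).

Notation Fc c := (F q c.1 c.2).
Notation harm := (harm q K r).
Notation bump := (bump q K r).
Notation sym := (sym q).

Lemma sum_lt3 (h : 'I_3 -> 'I_3 -> R) :
  \sum_(j < 3) \sum_(k < 3 | (j < k)%N) h j k = h 0 1 + h 0 2 + h 1 2.
Proof.
by under eq_bigr do rewrite big_mkcond sum3; rewrite sum3 /=; ring.
Qed.

Lemma graph_energy0 u v :
  graph_energy q r u v 0 = \sum_k v (q k) * flux (fun l => u (q l)) k.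
Proof.
rewrite /graph_energy (big_pred1 [tuple]) => [|w]; last first.
  by apply/esym/eqP; apply: val_inj; case: w => -[].
rewrite /res big_nil invr1 /=.
rewrite sum_lt3 /flux !sum3; ring.
Qed.

Lemma graph_energyS u v m : graph_energy q r u v m.+1
  = \sum_c cnd r c * graph_energy q r (u \o Fc c) (v \o Fc c) m.
Proof.
rewrite /graph_energy (sum_tuple_cons m (fun w => \sum_(j < 3) \sum_(k < 3 | (j < k)%N)
  (res r w)^-1 * (u (Fw q w (q j)) - u (Fw q w (q k)))
               * (v (Fw q w (q j)) - v (Fw q w (q k))))).
apply: eq_bigr => c _; rewrite mulr_sumr; apply: eq_bigr => w _.
rewrite mulr_sumr; apply: eq_bigr => j _; rewrite mulr_sumr; apply: eq_bigr => k _.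
rewrite /res big_cons invfM !mulrA; congr (_ * _ * _ * _).
by rewrite /cnd; case: ifP.
Qed.

Lemma graph_energy_ext u v v' m : (forall x, K x -> v x = v' x) ->
  graph_energy q r u v m = graph_energy q r u v' m.
Proof.
move=> vv'; apply: eq_bigr => w _; apply: eq_bigr => j _; apply: eq_bigr => k _.
by rewrite !vv' //; apply: (Fw_K K_gasket); exact: (q_K K_gasket).
Qed.

(** By [energy_restrict], refining leaves the energy against a harmonic function unchanged, so its
    value is found at level 0. *)
Lemma graph_energy_harm u b m :
  graph_energy q r u (harm b) m = \sum_k b k * flux (fun l => u (q l)) k.
Proof.
elim: m u b => [|m IH] u b.
  by rewrite graph_energy0; apply: eq_bigr => k _; rewrite harm_q.
rewrite graph_energyS.
have E c : graph_energy q r (u \o Fc c) (harm b \o Fc c) m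
    = \sum_k hext r c b k * flux (fun l => u (Fc c (q l))) k.
  rewrite (graph_energy_ext _ (v' := harm (hext r c b))) ?IH // => x Kx.
  exact: harm_F.
under eq_bigr do rewrite E.
under [RHS]eq_bigr => k _ do rewrite
  (energy_restrict r_gt0 k (sym_compat q_triangle u) : flux (fun l => u (q l)) k = _).
under [RHS]eq_bigr do rewrite mulr_sumr.
rewrite [RHS]exchange_big big_corner /=; apply: eq_bigr => c _.
rewrite mulr_sumr; apply: eq_bigr => k _; rewrite /hext mulr_suml mulr_sumr.
by apply: eq_bigr => l _; rewrite /sym /=; ring.
Qed.

Section TestFunction.
Variable B : cell -> 'I_3 -> R.
Hypothesis B_mate : forall x : corner, B (mate x).1 (mate x).2 = B x.1 x.2.
Hypothesis B_bdry : forall k, B (k, k) k = 0.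

(** Once the level reaches the cells on which the bump is harmonic, the graph energy is constant, so
    the limit defining [energy] is explicit. *)
Lemma graph_energy_bump w u m : graph_energy q r u (bump B w) (size w + m).+1
  = (res r w)^-1 * \sum_c cnd r c *
      \sum_k B c k * flux (fun l => u (Fw q w (Fc c (q l)))) k.
Proof.
elim: w u => [|c w IH] u; rewrite graph_energyS.
  rewrite /res big_nil invr1 mul1r; apply: eq_bigr => c _; congr (_ * _).
  rewrite (graph_energy_ext _ (v' := harm (B c))) ?graph_energy_harm // => x Kx.
  exact: bump_nil.
rewrite (bigD1 c) //= [X in _ + X]big1 ?addr0 => [|c' cc'].
  rewrite (graph_energy_ext _ (v' := bump B w)) => [|x Kx]; last first.
    by rewrite /= -/(bump B (c :: w)) bump_cons // eqxx.
  rewrite IH /res big_cons invfM mulrA; congr (_ * _ * _).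
  by rewrite /cnd; case: ifP.
rewrite (graph_energy_ext _ (v' := fun=> 0)) => [|x Kx]; last first.
  by rewrite /= -/(bump B (c :: w)) bump_cons // (negbTE cc').
rewrite /graph_energy big1 ?mulr0 // => v _; rewrite big1 // => j _.
by rewrite big1 // => k _; rewrite subrr mulr0.
Qed.

Lemma graph_energy_bump_cvg w u : graph_energy q r u (bump B w) @ \oo -->
  (res r w)^-1 * \sum_c cnd r c *
      \sum_k B c k * flux (fun l => u (Fw q w (Fc c (q l)))) k.
Proof.
rewrite -(cvg_shiftn (size w).+1).
rewrite (_ : (fun m => _) = fun=> (res r w)^-1 * \sum_c cnd r c *
      \sum_k B c k * flux (fun l => u (Fw q w (Fc c (q l)))) k).
  exact: cvg_cst.
by apply/funext => m; rewrite addnS addnC graph_energy_bump.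
Qed.

Lemma bump_continuous w : {within K, continuous (bump B w)}.
Proof. by apply: (cell_uniform_continuous K_gasket); exact: bump_unif. Qed.

Lemma bump_dom w : dom_energy q K r (bump B w).
Proof.
split; first exact: bump_continuous.
by apply/cvg_ex; eexists; exact: graph_energy_bump_cvg.
Qed.

Lemma bump_integral w f : {within K, continuous f} ->
  \int[mu]_(x in K) (bump B w x * f x)
  = mword r w * \sum_c msr r c * moment r (sh (rcons w c) (sym f)) (B c).
Proof.
elim: w f => [|c w IH] f cf.
  rewrite (integral_cells K_gasket r_gt0 mu_ss); last first.
    by apply: continuousM_K => //; exact: bump_continuous.
  rewrite /mword big_nil mul1r; apply: eq_bigr => c _; congr (_ * _).
  rewrite sh_sym (sym_moment q_triangle K_gasket r_gt0 mu_ss); last first.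
    exact: continuous_Fw.
  by apply: eq_Rintegral => x /set_mem Kx; rewrite bump_nil.
rewrite (integral_cells K_gasket r_gt0 mu_ss); last first.
  by apply: continuousM_K => //; exact: bump_continuous.
rewrite (bigD1 c) //= [X in _ + X]big1 ?addr0 => [|c' cc'].
  rewrite (@eq_Rintegral _ _ _ mu K (fun x => bump B w x * (f \o Fw q [:: c]) x)).
    rewrite IH; last exact: continuous_Fw.
    by rewrite /mword big_cons mulrA.
  move=> x /set_mem Kx; rewrite -/(bump B (c :: w)) bump_cons // eqxx.
  by [].
rewrite (@eq_Rintegral _ _ _ mu K (fun=> 0)).
  by rewrite Rintegral_cst ?mul0r ?mulr0 //; exact: (K_borel K_gasket).
by move=> x /set_mem Kx; rewrite -/(bump B (c :: w)) bump_cons // (negbTE cc') mul0r.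
Qed.

End TestFunction.

Lemma res_mword w : mword r w * res r w = L r ^+ size w.
Proof.
rewrite /mword /res; elim: w => [|c w IH]; first by rewrite !big_nil mulr1.
rewrite !big_cons mulrACA IH exprS; congr (_ * _).
have := msrE c r_gt0; have := cnd_gt0 c r_gt0; rewrite /cnd.
by case: ifP => _ c_gt0 ->; rewrite mulfVK // -invr_eq0 gt_eqF.
Qed.

Lemma res_gt0 w : 0 < res r w.
Proof.
rewrite /res; apply: prodr_gt0 => c _; have := cnd_gt0 c r_gt0.
by rewrite /cnd; case: ifP => _; rewrite invr_gt0.
Qed.

Lemma Lap_sym u f : is_laplacian q K r mu u f -> Lap r (sym u) (sym f).
Proof.
move=> [[cu _] cf weak] w x x_int.
(* The test bump is 1 at the junction, which has the two names [x] and [mate x], and 0 at every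
   other corner of V_1 of the cell [w]. *)
pose D (y : corner) := ((y == x) || (y == mate x))%:R : R.
pose B c k := D (c, k).
have B_mate (y : corner) : B (mate y).1 (mate y).2 = B y.1 y.2.
  rewrite /B -!surjective_pairing /D (inj_eq (inv_inj mateK)).
  by rewrite -[mate y == x](inj_eq (inv_inj mateK)) mateK orbC.
have B_bdry k : B (k, k) k = 0.
  rewrite /B /D; have kb : bdry (k, k, k) by rewrite /= !eqxx.
  case: eqP => [xE|_]; first by rewrite -xE kb in x_int.
  case: eqP => [xE|//]; by rewrite -bdry_mate -xE kb in x_int.
have := weak _ (bump_dom B_mate B_bdry w).
have -> : energy q r u (bump B w) = (res r w)^-1 * \sum_c cnd r c *
      \sum_k B c k * flux (fun l => u (Fw q w (Fc c (q l)))) k.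
  by apply/cvg_lim => //; exact: graph_energy_bump_cvg.
have V0_eq0 y : V0 q y -> bump B w y = 0.
  by case=> k _ <-; exact: bump_q.
move=> /(_ V0_eq0); rewrite bump_integral //.
have res0 := lt0r_neq0 (res_gt0 w).
have rV c : reg r (sh (rcons w c) (sym f)).
  by apply: reg_sh; exact: (sym_reg q_triangle K_gasket r_gt0 mu_ss).
(* This clears the resistance on the energy side; on the integral side [res_mword] leaves the power
   of [L r] occurring in [junc]. *)
move=> /(congr1 (fun t => res r w * t)); rewrite mulrN mulVKf // mulrA [res r w * _]mulrC.
rewrite res_mword => E.
have symE c : sym u (rcons w c) = fun l => u (Fw q w (Fc c (q l))).
  by apply/funext => l; rewrite /sym -cats1 Fw_cat.
have {E}: \sum_y D y * junc r (sym u) (sym f) w y = 0.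
  transitivity (\sum_c cnd r c * (\sum_k B c k * flux (fun l => u (Fw q w (Fc c (q l)))) k)
      + L r ^+ size w * \sum_c msr r c * moment r (sh (rcons w c) (sym f)) (B c)).
    rewrite big_corner [X in _ + X]mulr_sumr -big_split /=; apply: eq_bigr => c _.
    rewrite moment_bvec // !mulr_sumr -big_split /=; apply: eq_bigr => k _.
    by rewrite /junc /= symE msrE // exprSr -/(B c k); ring.
  by rewrite -E addrN.
rewrite (bigD1 x) //= (bigD1 (mate x)) ?mate_neq //= big1 ?addr0; last first.
  by move=> y /andP[yx ymx]; rewrite /D (negbTE yx) (negbTE ymx) mul0r.
rewrite /D !eqxx orbT !mul1r => /eqP.
by rewrite addrC addr_eq0 => /eqP.
Qed.

End Bridge.

(** * Monomials *)

Section Monomials.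
Context {R : realType} (q : 'I_3 -> plane R) (K : set (plane R)) (r : R).
Context (mu : probability (borel_plane R) R).
Hypotheses (q_triangle : is_triangle q) (K_gasket : is_gasket q K) (r_gt0 : 0 < r).
Hypothesis mu_ss : is_self_similar_measure q K r mu.
Implicit Types (u f g : plane R -> R).

Notation sym := (sym q).
Notation iter_lap := (is_iter_laplacian q K r mu).

Lemma iter_F m i x : iter m (F q i i) x = Fw q (nseq m (i, i)) x.
Proof. by elim: m => //= m ->. Qed.

Lemma normal_derivative_sym f d : has_normal_derivative q r f 0 d ->
  (fun m => r0 r ^- m * flux (sym f (nseq m (0, 0))) 0) @ \oo --> d.
Proof.
rewrite /has_normal_derivative; congr (_ @ \oo --> d).
apply/funext => m; rewrite !iter_F !I3E /flux sum3 /sym; congr (_ * _).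
have -> : Fw q (nseq m (0, 0)) (q 0) = q 0 by elim: m => //= m ->; rewrite F_q.
by ring.
Qed.

Lemma tangential_derivative_sym f d : has_tangential_derivative q r f 0 d ->
  tang r (sym f) @ \oo --> d.
Proof.
rewrite /has_tangential_derivative; congr (_ @ \oo --> d).
by apply/funext => m; rewrite !iter_F !I3E.
Qed.

Lemma eq_sym f g : (forall x, K x -> f x = g x) -> sym f = sym g.
Proof.
move=> fg; apply/funext => w; apply/funext => k; apply: fg.
by apply: (Fw_K K_gasket); exact: (q_K K_gasket).
Qed.

(** The intermediate functions of two iterations are chosen independently; [Lap_inj] identifies them
    on words, order by order. *)
Lemma iter_laplacian_unique l u f g : iter_lap l u f -> iter_lap l u g ->
  sym f = sym g.
Proof.
elim: l f g => [|l IH] f g /=.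
  by move=> fu gu; apply: eq_sym => x Kx; rewrite fu ?gu.
move=> [f' [If' Lf]] [g' [Ig' Lg]].
have [[cf' _] cf _] := Lf; have [_ cg _] := Lg.
have fg' := IH _ _ If' Ig'.
have regK h := sym_reg (g := h) q_triangle K_gasket r_gt0 mu_ss.
apply: (@Lap_inj _ _ r_gt0 (sym f')); try exact: regK.
- exact: (sym_scu K_gasket).
- exact: (sym_scu K_gasket).
- exact: (Lap_sym q_triangle K_gasket r_gt0 mu_ss Lf).
- by rewrite fg'; exact: (Lap_sym q_triangle K_gasket r_gt0 mu_ss Lg).
Qed.

Lemma monomial_chain j u : is_monomial q K r mu j 1 u ->
  exists V : nat -> seq cell -> 'I_3 -> R, [/\ flat_chain r V,
    forall l, V l [::] 0 = (j == l)%:R & V 0%N = sym u].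
Proof.
move=> [[n poly_u] /choice[f Hf]].
have iter_f l : iter_lap l u (f l) by have [] := Hf l.
(* Each [f l] comes with witnesses of its own. By uniqueness the one preceding [f l.+1] agrees with
   [f l] on words, which links all [f l] into one chain. *)
have pred_f l : exists g, sym g = sym (f l) /\ is_laplacian q K r mu g (f l.+1).
  have [g [Ig Lg]] := iter_f l.+1; exists g; split=> //.
  exact: iter_laplacian_unique Ig (iter_f l).
have regK h := sym_reg (g := h) q_triangle K_gasket r_gt0 mu_ss.
have reg_f l : reg r (sym (f l)).
  by have [g [<- [[cg _] _ _]]] := pred_f l; exact: regK.
have Lap_f l : Lap r (sym (f l)) (sym (f l.+1)).
  by have [g [<- Lg]] := pred_f l; exact: (Lap_sym q_triangle K_gasket r_gt0 mu_ss Lg).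
have scu_f l : scu (sym (f l)).
  by have [g [<- [[cg _] _ _]]] := pred_f l; exact: (sym_scu K_gasket).
exists (fun l => sym (f l)); split; last first.
- by apply: eq_sym; exact: (iter_f 0%N).
- by move=> l; have [_ + _ _] := Hf l; rewrite andbT.
split; first split => //.
  (* [is_polynomial] gives zero at order n + 1 only; the higher orders follow because zero is the
     only Laplacian of zero. *)
  exists n.+1 => l nl; rewrite -(subnKC nl); elim: (l - n.+1)%N => [|d IH].
    rewrite addn0 (iter_laplacian_unique (iter_f n.+1) poly_u).
    by apply/funext => w; apply/funext => k.
  have c0 : {within K, continuous (cst 0 : plane R -> R)} by exact: cst_continuous.
  have Lap00 : Lap r (sym (cst 0)) (sym (cst 0)).
    have flux0 w k : flux (sym (cst 0) w) k = 0.
      by rewrite /flux big1 // => i _; rewrite subrr.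
    by move=> w x _; rewrite /junc !moment_eq0 // !flux0 !(mulr0, addr0) oppr0.
  rewrite addnS; apply: (@Lap_inj _ _ r_gt0 (sym (cst 0)) _ (sym (cst 0))) => //.
  - exact: regK.
  - exact: regK.
  - exact: (sym_scu K_gasket c0).
  - by have := Lap_f (n.+1 + d)%N; rewrite IH.
move=> l; have [_ _ + +] := Hf l; rewrite !andbF => nd0 tang0.
split; last exact: tangential_derivative_sym.
have [g [fg [_ cg _]]] := pred_f l.+1; have [g' [fg' Lg']] := pred_f l.
have [g1 [g1E [[cg1 _] _ _]]] := pred_f l.+1.
have [M [_ HM]] := continuous_K_bounded K_gasket cg1.
have bound w k : `|sym (f l.+1) w k| <= M.
  by rewrite -g1E; apply: HM; apply: (Fw_K K_gasket); exact: (q_K K_gasket).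
have lim_nd := nd_limit r_gt0 (k := 0) (reg_f l) (reg_f l.+1) (Lap_f l) bound.
exact: cvg_unique lim_nd (normal_derivative_sym nd0).
Qed.

End Monomials.

(** * Junction equations with explicit weights *)

Section JunctionEquations.
Context {R : realType} (r : R).
Hypothesis r_gt0 : 0 < r.
Variable V : nat -> nat -> seq cell -> 'I_3 -> R.
Hypothesis flatV : forall j, flat_chain r (V j).
Hypothesis V_jet : forall j l, V j l [::] 0 = (j == l)%:R.

Let product_sum j (x : corner) : R :=
  \sum_(i < j.+1) L r ^+ i * V i 0%N [::] 1 * V (j - i)%N 0%N [:: x.1] x.2.

Let cndE : (r1 r)^-1 = r * (r0 r)^-1 /\ (r0 r)^-1 != 0.
Proof.
have c0 := cnd_gt0 (0, 0) r_gt0; rewrite /cnd /= in c0.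
split; last by rewrite gt_eqF.
have [? ? ? ? ?] := side_conditions r_gt0.
by rewrite /r1 /r0 /Dpoly; field; do !(apply/andP; split).
Qed.

Lemma junction_inner j (x : corner) : x.1.1 != x.1.2 ->
  (mate x).1.1 != (mate x).1.2 ->
  star (V j 0%N) x + star (V j 0%N) (mate x) = 4 * product_sum j x.
Proof.
move=> x1 x2; have x_int : ~~ bdry x by case: x x1 {x2} => [[i k] l] /= /negbTE->.
have := P_junction r_gt0 flatV V_jet j x_int.
rewrite /cnd (negbTE x1) (negbTE x2) -/(product_sum j x).
have [-> c0] := cndE; have rc0 : r * (r0 r)^-1 != 0.
  by apply: mulf_neq0; first exact: lt0r_neq0.
move: rc0; move: (r * _) => z z0 E; apply: (mulfI z0).
by rewrite mulrDr E; ring.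
Qed.

(** The conductances are 1 / r0 and r / r0; dividing by 1 / r0 leaves the weights 1 and r. *)
Lemma junction_mixed j (x : corner) : x.1.1 == x.1.2 ->
  (mate x).1.1 != (mate x).1.2 ->
  star (V j 0%N) x + r * star (V j 0%N) (mate x) = (2 + 2 * r) * product_sum j x.
Proof.
move=> x1 x2; have x_int : ~~ bdry x.
  by rewrite -bdry_mate; case: (mate x) x2 => [[i k] l] /= /negbTE->.
have := P_junction r_gt0 flatV V_jet j x_int.
rewrite /cnd x1 (negbTE x2) -/(product_sum j x).
have [-> c0] := cndE; move: c0; move: (_^-1) => z z0 E; apply: (mulfI z0).
by rewrite mulrDr [z * (r * _)]mulrA [z * r]mulrC E; ring.
Qed.

End JunctionEquations.

Theorem theorem2p6 (R : realType) (q : 'I_3 -> plane R) (hq : is_triangle q)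
  (SG : set (plane R)) (hSG : is_gasket q SG)
  (r : R) (hr : 0 < r)
  (mu : probability (borel_plane R) R)
  (hmu : is_self_similar_measure q SG r mu)
  (P : nat -> plane R -> R)
  (hP : forall j : nat, is_monomial q SG r mu j 1 (P j)) :
  let alpha j := P j (q 1) in
  let a j := P j (F q 0 1 (q 1)) in
  let b j := P j (F q 0 1 (q 2)) in
  let c j := P j (F q 1 1 (q 0)) in
  let d j := P j (F q 1 0 (q 2)) in
  let e j := P j (F q 1 1 (q 2)) in
  let f j := P j (F q 1 2 (q 2)) in
  (forall j : nat,
    [/\ (j == 0%N)%:R + L r ^+ j * alpha j + r * a j + r * b j
          = (2 + 2 * r) * \sum_(i < j.+1) L r ^+ j * alpha i * alpha (j - i)%N,
        L r ^+ j * alpha j + b j + c j + d j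
          = 4 * \sum_(i < j.+1) L r ^+ i * alpha i * a (j - i)%N,
        2 * L r ^+ j * alpha j + 2 * a j
          = 4 * \sum_(i < j.+1) L r ^+ i * alpha i * b (j - i)%N,
        alpha j + r * a j + r * d j + e j
          = (2 + 2 * r) * \sum_(i < j.+1) L r ^+ i * alpha i * c (j - i)%N &
    [/\ a j + c j + e j + f j
          = 4 * \sum_(i < j.+1) L r ^+ i * alpha i * d (j - i)%N,
        alpha j + c j + r * d j + r * f j
          = (2 + 2 * r) * \sum_(i < j.+1) L r ^+ i * alpha i * e (j - i)%N &
        2 * d j + 2 * e j
          = 4 * \sum_(i < j.+1) L r ^+ i * alpha i * f (j - i)%N]])
  /\ [/\ alpha 0%N = 1, a 0%N = 1, b 0%N = 1, c 0%N = 1 &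
     [/\ d 0%N = 1, e 0%N = 1, f 0%N = 1 & alpha 1%N = 6^-1]].
Proof.
move=> alpha a b c d e f.
have [V HV] := choice (fun j => monomial_chain hq hSG hr hmu (hP j)).
have flatV j : flat_chain r (V j) by have [] := HV j.
have V_jet j l : V j l [::] 0 = (j == l)%:R by have [_ ->] := HV j.
have VE j w k : V j 0%N w k = P j (Fw q w (q k)) by have [_ _ ->] := HV j.
split; last first.
  have one w k : P 0%N (Fw q w (q k)) = 1 by rewrite -VE; exact: (P0_eq1 hr flatV V_jet).
  split; [exact: (one [::])|exact: (one [:: (0, 1)])|exact: (one [:: (0, 1)])|
          exact: (one [:: (1, 1)])|split].
  - exact: (one [:: (1, 0)]).
  - exact: (one [:: (1, 1)]).
  - exact: (one [:: (1, 2)]).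
  - by rewrite /alpha -(VE 1%N [::]); exact: (P1_mean hr flatV V_jet).
move=> j.
have alphaE i : V i 0%N [::] 1 = alpha i by rewrite VE.
have compV : compat (V j 0%N).
  by have [[+ _ _] _] := flatV j; move=> /(_ 0%N)[].
have corner k : V j 0%N [:: (k, k)] k = V j 0%N [::] k.
  by have [+ _] := compV; move=> /(_ [::] k).
have glued x : V j 0%N [:: (mate x).1] (mate x).2 = V j 0%N [:: x.1] x.2.
  by have [_ H] := compV; exact: (H [::] x).
have mirror := P_tau hr flatV V_jet j.
have small := P_corner hr flatV V_jet.
have a' : V j 0%N [:: (0, 1)] 1 = a j by rewrite VE.
have b' : V j 0%N [:: (0, 1)] 2 = b j by rewrite VE.
have c' : V j 0%N [:: (1, 1)] 0 = c j by rewrite VE.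
have d' : V j 0%N [:: (1, 0)] 2 = d j by rewrite VE.
have e' : V j 0%N [:: (1, 1)] 2 = e j by rewrite VE.
have f' : V j 0%N [:: (1, 2)] 2 = f j by rewrite VE.
have alpha2 : V j 0%N [::] 2 = alpha j.
  by rewrite -alphaE -mirror /= !tauE.
have p0 : V j 0%N [:: (0, 0)] 0 = (j == 0%N)%:R by rewrite corner V_jet.
have p1 i : V i 0%N [:: (0, 0)] 1 = L r ^+ i * alpha i by rewrite small alphaE.
have p2 : V j 0%N [:: (0, 0)] 2 = L r ^+ j * alpha j by rewrite small alpha2.
have p1' : V j 0%N [:: (0, 1)] 0 = L r ^+ j * alpha j.
  by rewrite -p1 -(glued (0, 0, 1)).
have c'' : V j 0%N [:: (1, 0)] 1 = c j by rewrite -c' -(glued (1, 1, 0)).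
have a'' : V j 0%N [:: (1, 0)] 0 = a j by rewrite -a' -(glued (0, 1, 1)).
have d'' : V j 0%N [:: (1, 2)] 0 = d j by rewrite -d' -(glued (1, 0, 2)).
have e'' : V j 0%N [:: (1, 2)] 1 = e j by rewrite -e' -(glued (1, 1, 2)).
have q1 : V j 0%N [:: (1, 1)] 1 = alpha j by rewrite corner alphaE.
(* Neighbours in cells on the q_2 side are brought back by the reflection. *)
have m1 : V j 0%N [:: (0, 2)] 0 = L r ^+ j * alpha j.
  by rewrite -p1' -[RHS]mirror /= /perm_cell /= !tauE.
have m2 : V j 0%N [:: (0, 2)] 2 = a j.
  by rewrite -a' -[RHS]mirror /= /perm_cell /= !tauE.
have m3 : V j 0%N [:: (2, 1)] 0 = d j.
  by rewrite -d'' -[RHS]mirror /= /perm_cell /= !tauE.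
have m4 : V j 0%N [:: (2, 1)] 2 = e j.
  by rewrite -e'' -[RHS]mirror /= /perm_cell /= !tauE.
have mixed := junction_mixed hr flatV V_jet j.
have inner := junction_inner hr flatV V_jet j.
split; [| | | |split].
(* The value at this junction is itself a rescaled alpha: L^i times L^(j-i) gives the power L^j
   peculiar to this equation. *)
- have := mixed (0, 0, 1) isT isT; rewrite /star !sum3 /= p0 p1 p2 p1' a' b'.
  have -> : \sum_(i < j.+1) L r ^+ i * V i 0%N [::] 1 * V (j - i)%N 0%N [:: (0, 0)] 1
      = \sum_(i < j.+1) L r ^+ j * alpha i * alpha (j - i)%N.
    apply: eq_bigr => i _; rewrite p1 alphaE.
    have -> : L r ^+ j = L r ^+ i * L r ^+ (j - i) by rewrite -exprD subnKC // leq_ord.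
    by ring.
  by move=> E; rewrite -E; ring.
- have := inner (0, 1, 1) isT isT; rewrite /star !sum3 /= p1' a' b' a'' c'' d' => E.
  under eq_bigr do rewrite -alphaE /a -(VE _ [:: (0, 1)]).
  by rewrite -E; ring.
(* This junction lies on the axis of the reflection, so the neighbours in both cells have the same
   values, whence the doubled coefficients; likewise in the last equation. *)
- have := inner (0, 1, 2) isT isT; rewrite /star !sum3 /= p1' a' b' m1 m2 => E.
  under eq_bigr do rewrite -alphaE /b -(VE _ [:: (0, 1)]).
  by rewrite -E; ring.
- have := mixed (1, 1, 0) isT isT; rewrite /star !sum3 /= c' q1 e' a'' c'' d' => E.
  under eq_bigr do rewrite -alphaE /c -(VE _ [:: (1, 1)]).
  by rewrite -E; ring.
- have := inner (1, 0, 2) isT isT; rewrite /star !sum3 /= a'' c'' d' d'' e'' f' => E.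
  under eq_bigr do rewrite -alphaE /d -(VE _ [:: (1, 0)]).
  by rewrite -E; ring.
- have := mixed (1, 1, 2) isT isT; rewrite /star !sum3 /= c' q1 e' d'' e'' f' => E.
  under eq_bigr do rewrite -alphaE /e -(VE _ [:: (1, 1)]).
  by rewrite -E; ring.
- have := inner (1, 2, 2) isT isT; rewrite /star !sum3 /= d'' e'' f' m3 m4 => E.
  under eq_bigr do rewrite -alphaE /f -(VE _ [:: (1, 2)]).
  by rewrite -E; ring.
Qed.
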